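(* Let $(N^{2n+1},\phi,\xi,\eta,g)$ be a Sasakian manifold endowed with the Tanaka-Webster connection $\widehat{\nabla}$, and let $q\in\mathbb{R}$, $q\neq 0$. Let $\alpha:I\rightarrow N$ be a curve parametrized by arc-length, with $E_1=\alpha'$. Then $\alpha$ is pseudo-Hermitian magnetic, i.e. $\widehat{\nabla}_{E_1}E_1=[-q+2\eta(E_1)]\phi E_1$, if and only if it belongs to the following list: (a) pseudo-Hermitian non-Legendre slant geodesics (including pseudo-Hermitian geodesics as integral curves of $\xi$); (b) pseudo-Hermitian Legendre circles with $\widehat{k}_1=|q|$ and having the Frenet frame field (for $\widehat{\nabla}$) $\{E_1,-\mathrm{sgn}(q)\phi E_1\}$; (c) pseudo-Hermitian slant helices with $$\widehat{k}_1=|-q+2\cos\theta|\sin\theta,\qquad \widehat{k}_2=|-q+2\cos\theta|\,\varepsilon\cos\theta,$$ and having the Frenet frame field (for $\widehat{\nabla}$) $$\left\{E_1,\ \frac{\delta}{\sin\theta}\phi E_1,\ \frac{\varepsilon}{\sin\theta}(\xi-\cos\theta\, E_1)\right\},$$ where $\theta$ is the contact angle of $\alpha$, $\delta=\mathrm{sgn}(-q+2\cos\theta)$, $\varepsilon=\mathrm{sgn}(\cos\theta)$ and $\cos\theta\neq\frac{q}{2}$.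
   Context: An almost contact metric manifold $(N^{2n+1},\phi,\xi,\eta,g)$ is a $(2n+1)$-dimensional manifold with a $(1,1)$-tensor field $\phi$, a vector field $\xi$, a 1-form $\eta$ and a Riemannian metric $g$ such that $\phi^2X=-X+\eta(X)\xi$, $\eta(\xi)=1$, $\phi\xi=0$, $\eta\circ\phi=0$, $g(X,\xi)=\eta(X)$, $g(X,Y)=g(\phi X,\phi Y)+\eta(X)\eta(Y)$. It is a contact metric manifold if $d\eta(X,Y)=g(X,\phi Y)$, and Sasakian if it is contact metric and the Nijenhuis torsion satisfies $[\phi,\phi](X,Y)=-2d\eta(X,Y)\xi$; here $d\eta(X,Y)=\frac12(X\eta(Y)-Y\eta(X)-\eta([X,Y]))$. With $\nabla$ the Levi-Civita connection, the Tanaka-Webster connection of a Sasakian manifold is $$\widehat{\nabla}_XY=\nabla_XY+\eta(X)\phi Y+\eta(Y)\phi X-g(\phi X,Y)\xi.$$ Pseudo-Hermitian magnetic curve: a unit-speed curve $\alpha$ with $E_1=\alpha'$ is a normal magnetic curve with respect to $\widehat{\nabla}$ (pseudo-Hermitian magnetic), for the contact magnetic field $F_q(X,Y)=q\,g(X,\phi Y)$ of strength $q$, if $\widehat{\nabla}_{E_1}E_1=[-q+2\eta(E_1)]\phi E_1$. Throughout, $q\neq0$. A unit-speed curve $\alpha$ is slant if $\eta(E_1)=\cos\theta$ is constant; $\theta\in[0,\pi]$ is its contact angle. It is Legendre if $\eta(E_1)=0$. Frenet curves: a unit-speed curve $\alpha$ is a Frenet curve for $\widehat{\nabla}$ of osculating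 order $r$ if there are $g$-orthonormal vector fields $E_1=\alpha',E_2,\dots,E_r$ along $\alpha$ and positive functions $\widehat{k}_1,\dots,\widehat{k}_{r-1}$ on $I$ (pseudo-Hermitian curvatures) with $\widehat{\nabla}_{E_1}E_1=\widehat{k}_1E_2$, $\widehat{\nabla}_{E_1}E_i=-\widehat{k}_{i-1}E_{i-1}+\widehat{k}_iE_{i+1}$ for $1<i<r$, and $\widehat{\nabla}_{E_1}E_r=-\widehat{k}_{r-1}E_{r-1}$ (for $r=1$: $\widehat{\nabla}_{E_1}E_1=0$). A pseudo-Hermitian geodesic is a Frenet curve for $\widehat{\nabla}$ of osculating order $1$; a pseudo-Hermitian circle is one of osculating order $2$ with $\widehat{k}_1$ constant; a pseudo-Hermitian helix is one of osculating order $3$ with $\widehat{k}_1,\widehat{k}_2$ non-zero positive constants.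
   Formalization: Item (a) is restricted to non-Legendre slant geodesics with cos θ = q/2 or E_1 = ±ξ, because a pseudo-Hermitian geodesic with any other contact angle satisfies the literal (a) but is not magnetic of strength q. *)

(* Defs.v *)
From HB Require Import structures.
From mathcomp Require Import all_boot all_order all_algebra.
From mathcomp Require Import all_classical all_reals all_analysis.
Set Implicit Arguments.
Unset Strict Implicit.
Unset Printing Implicit Defensive.
Import Order.TTheory GRing.Theory Num.Theory.
Import numFieldNormedType.Exports.
Local Open Scope classical_set_scope.
Local Open Scope ring_scope.

(* ------------------------------------------------------------------------- *)
(* Smooth manifolds.  Tangent vectors are row vectors of chart components;   *)
(* a linear map acts by multiplication on the right, as in the library's     *)
(* Jacobian: u *m 'J f x = 'd f x u.                                         *)
(* ------------------------------------------------------------------------- *)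

Fixpoint iter_derive (R : realType) (V W : normedModType R) (vs : seq V)
    (f : V -> W) : V -> W :=
  if vs is v :: vs' then fun x => 'D_v (iter_derive vs' f) x else f.

(* C^infinity on an open set: all iterated directional derivatives exist and
   are differentiable. *)
Definition smooth_on (R : realType) (V W : normedModType R) (U : set V)
    (f : V -> W) : Prop :=
  forall (vs : seq V) (x : V), U x -> differentiable (iter_derive vs f) x.

Record smooth_manifold (R : realType) (m : nat) := SmoothManifold {
  carrier :> topologicalType ;
  chart_index : Type ;
  dom : chart_index -> set carrier ;
  chart : chart_index -> carrier -> 'rV[R]_m ;
  chart_inv : chart_index -> 'rV[R]_m -> carrier ;
  manifold_hausdorff : hausdorff_space carrier ;
  manifold_second_countable : @second_countable carrier ;
  dom_open : forall c, open (dom c) ;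
  dom_cover : forall p, exists c, dom c p ;
  chart_open : forall c, open (chart c @` dom c) ;
  chartK : forall c p, dom c p -> chart_inv c (chart c p) = p ;
  chart_continuous : forall c p, dom c p -> {for p, continuous (chart c)} ;
  chart_inv_continuous : forall c x, (chart c @` dom c) x ->
    {for x, continuous (chart_inv c)} ;
  transition_smooth : forall c c',
    smooth_on (chart c @` (dom c `&` dom c')) (chart c' \o chart_inv c) }.

Section Tensors.
Variables (R : realType) (m : nat) (N : smooth_manifold R m).

Definition cod (c : chart_index N) : set 'rV[R]_m := chart c @` dom c.
Definition overlap (c c' : chart_index N) : set 'rV[R]_m :=
  chart c @` (dom c `&` dom c').
Definition transition (c c' : chart_index N) : 'rV[R]_m -> 'rV[R]_m :=
  chart c' \o chart_inv c.

(* Tensor fields are families of components, one for each chart, as functions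
   of the coordinates; only the values on cod c are meaningful. *)
Definition vector_components := chart_index N -> 'rV[R]_m -> 'rV[R]_m.
Definition form_components := chart_index N -> 'rV[R]_m -> 'cV[R]_m.
Definition matrix_components := chart_index N -> 'rV[R]_m -> 'M[R]_m.
(* Christoffel symbols: G c x u v = sum_(i, j, k) u_i v_j Gamma_ij^k e_k. *)
Definition connection_components :=
  chart_index N -> 'rV[R]_m -> 'rV[R]_m -> 'rV[R]_m -> 'rV[R]_m.

Definition is_vector_field (X : vector_components) : Prop :=
  (forall c, smooth_on (cod c) (X c)) /\
  (forall c c' x, overlap c c' x ->
     X c' (transition c c' x) = X c x *m 'J (transition c c') x).

Definition is_one_form (eta : form_components) : Prop :=
  (forall c, smooth_on (cod c) (eta c)) /\
  (forall c c' x, overlap c c' x ->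
     'J (transition c c') x *m eta c' (transition c c' x) = eta c x).

Definition is_endomorphism_field (phi : matrix_components) : Prop :=
  (forall c, smooth_on (cod c) (phi c)) /\
  (forall c c' x, overlap c c' x ->
     'J (transition c c') x *m phi c' (transition c c' x) =
     phi c x *m 'J (transition c c') x).

Definition eval_form (eta : form_components) c x (u : 'rV[R]_m) : R :=
  (u *m eta c x) 0 0.
Definition eval_endo (phi : matrix_components) c x (u : 'rV[R]_m) : 'rV[R]_m :=
  u *m phi c x.
Definition eval_metric (g : matrix_components) c x (u v : 'rV[R]_m) : R :=
  (u *m g c x *m v^T) 0 0.

Definition is_riemannian_metric (g : matrix_components) : Prop :=
  [/\ forall c, smooth_on (cod c) (g c),
      forall c c' x, overlap c c' x ->
        'J (transition c c') x *m g c' (transition c c' x)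
          *m ('J (transition c c') x)^T = g c x,
      forall c x u v, cod c x -> eval_metric g c x u v = eval_metric g c x v u
    & forall c x u, cod c x -> u != 0 -> 0 < eval_metric g c x u u].

(* The inhomogeneous term is the second derivative of the coordinate change. *)
Definition is_connection (G : connection_components) : Prop :=
  [/\ forall c x a u u' v, cod c x ->
        G c x (a *: u + u') v = a *: G c x u v + G c x u' v,
      forall c x a u v v', cod c x ->
        G c x u (a *: v + v') = a *: G c x u v + G c x u v',
      forall c u v, smooth_on (cod c) (fun x => G c x u v)
    & forall c c' x u v, overlap c c' x ->
        let J := 'J (transition c c') x in
        G c x u v *m J = G c' (transition c c' x) (u *m J) (v *m J)
          + 'D_u ('D_v (transition c c')) x].

(* Below, X and Y are local vector fields, defined on the domain of a chart. *)
Definition lie_bracket (X Y : 'rV[R]_m -> 'rV[R]_m) (x : 'rV[R]_m) : 'rV[R]_m :=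
  'D_(X x) Y x - 'D_(Y x) X x.

Definition cov_deriv (G : connection_components) c
    (X Y : 'rV[R]_m -> 'rV[R]_m) (x : 'rV[R]_m) : 'rV[R]_m :=
  'D_(X x) Y x + G c x (X x) (Y x).

Definition torsion_free (G : connection_components) : Prop :=
  forall c X Y, smooth_on (cod c) X -> smooth_on (cod c) Y ->
  forall x, cod c x ->
    cov_deriv G c X Y x - cov_deriv G c Y X x = lie_bracket X Y x.

Definition metric_compatible (g : matrix_components)
    (G : connection_components) : Prop :=
  forall c X Y Z, smooth_on (cod c) X -> smooth_on (cod c) Y ->
    smooth_on (cod c) Z -> forall x, cod c x ->
    'D_(X x) (fun y => eval_metric g c y (Y y) (Z y)) x =
    eval_metric g c x (cov_deriv G c X Y x) (Z x) +
    eval_metric g c x (Y x) (cov_deriv G c X Z x).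

Definition levi_civita (g : matrix_components) (G : connection_components)
    : Prop :=
  [/\ is_connection G, torsion_free G & metric_compatible g G].

End Tensors.

(* ------------------------------------------------------------------------- *)
(* Contact geometry.                                                         *)
(* ------------------------------------------------------------------------- *)

Section Contact.
Variables (R : realType) (m : nat) (N : smooth_manifold R m).
Variables (phi : matrix_components N) (xi : vector_components N).
Variables (eta : form_components N) (g : matrix_components N).

Record almost_contact_metric : Prop := AlmostContactMetric {
  phi_field : is_endomorphism_field phi ;
  xi_field : is_vector_field xi ;
  eta_form : is_one_form eta ;
  g_riemannian : is_riemannian_metric g ;
  phi_sqr : forall c x u, cod c x ->
    eval_endo phi c x (eval_endo phi c x u) =
    - u + eval_form eta c x u *: xi c x ;
  eta_xi : forall c x, cod c x -> eval_form eta c x (xi c x) = 1 ;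
  phi_xi : forall c x, cod c x -> eval_endo phi c x (xi c x) = 0 ;
  eta_phi : forall c x u, cod c x ->
    eval_form eta c x (eval_endo phi c x u) = 0 ;
  g_xi : forall c x u, cod c x ->
    eval_metric g c x u (xi c x) = eval_form eta c x u ;
  g_phi : forall c x u v, cod c x ->
    eval_metric g c x u v =
    eval_metric g c x (eval_endo phi c x u) (eval_endo phi c x v) +
    eval_form eta c x u * eval_form eta c x v }.

(* Exterior derivative, with the factor 1/2. *)
Definition d_form c (X Y : 'rV[R]_m -> 'rV[R]_m) (x : 'rV[R]_m) : R :=
  2^-1 * ('D_(X x) (fun y => eval_form eta c y (Y y)) x
          - 'D_(Y x) (fun y => eval_form eta c y (X y)) x
          - eval_form eta c x (lie_bracket X Y x)).

Definition nijenhuis c (X Y : 'rV[R]_m -> 'rV[R]_m) (x : 'rV[R]_m)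
    : 'rV[R]_m :=
  let pX := fun y => eval_endo phi c y (X y) in
  let pY := fun y => eval_endo phi c y (Y y) in
  eval_endo phi c x (eval_endo phi c x (lie_bracket X Y x))
  + lie_bracket pX pY x
  - eval_endo phi c x (lie_bracket pX Y x)
  - eval_endo phi c x (lie_bracket X pY x).

Definition contact_metric : Prop :=
  almost_contact_metric /\
  forall c X Y, smooth_on (cod c) X -> smooth_on (cod c) Y ->
  forall x, cod c x ->
    d_form c X Y x = eval_metric g c x (X x) (eval_endo phi c x (Y x)).

Definition sasakian : Prop :=
  contact_metric /\
  forall c X Y, smooth_on (cod c) X -> smooth_on (cod c) Y ->
  forall x, cod c x ->
    nijenhuis c X Y x = - (2 * d_form c X Y x) *: xi c x.

(* The difference with the Levi-Civita connection G is tensorial, so the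
   defining formula is an equality of Christoffel symbols. *)
Definition tanaka_webster (G : connection_components N)
    : connection_components N :=
  fun c x u v =>
    G c x u v + eval_form eta c x u *: eval_endo phi c x v
    + eval_form eta c x v *: eval_endo phi c x u
    - eval_metric g c x (eval_endo phi c x u) v *: xi c x.

End Contact.

(* ------------------------------------------------------------------------- *)
(* Curves.                                                                   *)
(* ------------------------------------------------------------------------- *)

Section Curves.
Variables (R : realType) (m : nat) (N : smooth_manifold R m).
Variables (I : set R) (alpha : R -> N).

(* Only the values of alpha on I matter. *)
Definition curve_dom (c : chart_index N) : set R :=
  [set t | I t /\ dom c (alpha t)].
Definition coords (c : chart_index N) (t : R) : 'rV[R]_m := chart c (alpha t).

Definition smooth_curve : Prop :=
  (forall t, I t -> {for t, continuous alpha}) /\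
  (forall c, smooth_on (curve_dom c) (coords c)).

(* Vectors along alpha: components in each chart, meaningful on curve_dom c. *)
Definition along := chart_index N -> R -> 'rV[R]_m.

Definition along_eq (V W : along) : Prop :=
  forall c t, curve_dom c t -> V c t = W c t.

Definition is_field_along (V : along) : Prop :=
  (forall c, smooth_on (curve_dom c) (V c)) /\
  (forall c c' t, curve_dom c t -> curve_dom c' t ->
     V c' t = V c t *m 'J (transition c c') (coords c t)).

Definition velocity : along := fun c t => 'D_1 (coords c) t.

Definition vector_along (X : vector_components N) : along :=
  fun c t => X c (coords c t).
Definition endo_along (phi : matrix_components N) (V : along) : along :=
  fun c t => eval_endo phi c (coords c t) (V c t).
Definition form_along (eta : form_components N) (V : along)
    (c : chart_index N) (t : R) : R :=
  eval_form eta c (coords c t) (V c t).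
Definition metric_along (g : matrix_components N) (V W : along)
    (c : chart_index N) (t : R) : R :=
  eval_metric g c (coords c t) (V c t) (W c t).

(* Covariant derivative of V in the direction alpha'. *)
Definition cov_along (G : connection_components N) (V : along) : along :=
  fun c t => 'D_1 (V c) t + G c (coords c t) (velocity c t) (V c t).

Definition unit_speed (g : matrix_components N) : Prop :=
  forall c t, curve_dom c t -> metric_along g velocity velocity c t = 1.

(* Frames and curvatures are numbered from 1; E 0 and k 0 are not used. *)
Definition frenet (g : matrix_components N) (G : connection_components N)
    (r : nat) (E : nat -> along) (k : nat -> R -> R) : Prop :=
  [/\ [/\ (0 < r)%N,
          forall i, (1 <= i <= r)%N -> is_field_along (E i)
        & along_eq (E 1%N) velocity],
      forall i j, (1 <= i <= r)%N -> (1 <= j <= r)%N ->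
        forall c t, curve_dom c t ->
        metric_along g (E i) (E j) c t = (i == j)%:R,
      forall i, (1 <= i < r)%N -> forall t, I t -> 0 < k i t
    & forall i, (1 <= i <= r)%N ->
        along_eq (cov_along G (E i)) (fun c t =>
          (if (1 < i)%N then - k i.-1 t *: E i.-1 c t else 0)
          + (if (i < r)%N then k i t *: E i.+1 c t else 0))].

Definition geodesic (g : matrix_components N) (G : connection_components N)
    (E : nat -> along) (k : nat -> R -> R) : Prop :=
  frenet g G 1 E k.

Definition circle (g : matrix_components N) (G : connection_components N)
    (E : nat -> along) (k : nat -> R -> R) : Prop :=
  frenet g G 2 E k /\ exists k1 : R, forall t, I t -> k 1%N t = k1.

Definition helix (g : matrix_components N) (G : connection_components N)
    (E : nat -> along) (k : nat -> R -> R) : Prop :=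
  frenet g G 3 E k /\
  exists k1 k2 : R, [/\ 0 < k1, 0 < k2
    & forall t, I t -> k 1%N t = k1 /\ k 2%N t = k2].

(* alpha is slant, with contact angle theta. *)
Definition slant (eta : form_components N) (theta : R) : Prop :=
  0 <= theta <= pi /\
  forall c t, curve_dom c t -> form_along eta velocity c t = cos theta.

Definition legendre (eta : form_components N) : Prop :=
  forall c t, curve_dom c t -> form_along eta velocity c t = 0.

(* The equation of normal magnetic curves of the contact magnetic field of
   strength q, for G the Tanaka-Webster connection. *)
Definition magnetic (phi : matrix_components N) (eta : form_components N)
    (G : connection_components N) (q : R) : Prop :=
  along_eq (cov_along G velocity) (fun c t =>
    (- q + 2 * form_along eta velocity c t) *: endo_along phi velocity c t).

End Curves.
Arguments velocity {R m N} alpha _ _.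

(* Main.v *)
Require Import Defs.
From HB Require Import structures.
From mathcomp Require Import all_boot all_order all_algebra.
From mathcomp Require Import all_classical all_reals all_analysis.
From mathcomp Require Import ring lra.
Import Order.TTheory GRing.Theory Num.Theory.
Import numFieldNormedType.Exports.
Local Open Scope classical_set_scope.
Local Open Scope ring_scope.

(** The Tanaka-Webster connection of a Sasakian manifold makes xi, eta and phi
    parallel, so that along any curve its covariant derivative commutes with phi
    and kills xi.  Everything else is algebra in the span of E1, phi E1 and xi.

    If the curve is magnetic, then eta(E1)' = eta(lambda phi E1) = 0, where
    lambda = - q + 2 eta(E1): the function eta(E1) is locally constant, hence
    constant on the interval, and it is the cosine of an angle because
    |xi - k E1|^2 = 1 - k^2 >= 0 for k = eta(E1) (magnetic_slant, slant_bound).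
    Parallelism of phi then gives the derivatives
      E1' = lambda phi E1,   (phi E1)' = lambda (- E1 + k xi),
      (xi - k E1)' = - k lambda phi E1,
    and these are the Frenet equations of the frames in the list once the three
    vectors are normalised by |phi E1| = |xi - k E1| = sin theta.  The curve is
    a geodesic when lambda = 0 or when sin theta = 0, that is xi = k E1 with
    k = 1 or k = -1; it is a circle when k = 0, since then the second
    derivative falls back on E1 (magnetic_circle); otherwise it is a helix
    (magnetic_helix).  Conversely, the first Frenet equation of each curve in
    the list is the magnetic equation (frenet_cov1).

    Parallelism amounts to the two classical formulas
      (nabla_u phi) v = g(u, v) xi - eta(v) u,     nabla_u xi = - phi u
    for the Levi-Civita connection (sasakian_nabla).  They are pointwise
    statements, proved in one chart with constant vector fields.  Put
    a(u, v, w) = g((nabla_u phi) v, w).  Then a is skew in v and w because phi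
    is; its cyclic sum vanishes because the fundamental 2-form g(u, phi v) is
    d eta, hence closed, which is the symmetry of second derivatives
    (derive_swap); and vanishing of the normality tensor is a linear equation
    for a.  The difference t of a and its expected value solves the homogeneous
    equations, and two cyclic permutations of them force t = 0
    (sasakian_tensors). *)
Set Implicit Arguments.
Unset Strict Implicit.
Unset Printing Implicit Defensive.

(** * Differential calculus of matrix-valued functions *)

Section MatrixCalculus.
Variables (R : realType) (V : normedModType R).

Lemma differentiable_fsum n (f : 'I_n -> V -> R) x :
  (forall i, differentiable (f i) x) ->
  differentiable (fun y => \sum_(i < n) f i y) x.
Proof.
move=> df; rewrite (_ : (fun y => _) = \sum_(i < n) f i).
  exact: differentiable_sum.
by apply/funext => y; rewrite fct_sumE.
Qed.

Lemma differentiable_entry m n (M : V -> 'M[R]_(m, n)) x i j :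
  differentiable M x -> differentiable (fun y => M y i j) x.
Proof.
move=> dM; apply: (@differentiable_comp _ _ _ _ M (fun A => A i j)) => //.
exact: differentiable_coord.
Qed.

Lemma differentiable_mx m n (M : V -> 'M[R]_(m, n)) x :
  (forall i j, differentiable (fun y => M y i j) x) -> differentiable M x.
Proof.
move=> dM; rewrite (_ : M = \sum_(i < m) \sum_(j < n)
    (fun y => M y i j *: (delta_mx i j : 'M[R]_(m, n)))).
  apply: differentiable_sum => i; apply: differentiable_sum => j.
  exact: differentiableZl.
apply/funext => y; rewrite fct_sumE [LHS]matrix_sum_delta.
by apply: eq_bigr => i _; rewrite fct_sumE.
Qed.

Lemma derive_entry m n (M : V -> 'M[R]_(m, n)) x v i j :
  differentiable M x -> 'D_v M x i j = 'D_v (fun y => M y i j) x.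
Proof. by move=> dM; rewrite derive_mx ?mxE//; exact: diff_derivable. Qed.

Lemma differentiable_mulmx m n p (P : V -> 'M[R]_(m, n))
    (Q : V -> 'M[R]_(n, p)) x :
  differentiable P x -> differentiable Q x ->
  differentiable (fun y => P y *m Q y) x.
Proof.
move=> dP dQ; apply: differentiable_mx => i j.
rewrite (_ : (fun y => _) = fun y => \sum_(k < n) P y i k * Q y k j).
  apply: differentiable_fsum => k; apply: differentiableM;
  exact: differentiable_entry.
by apply/funext => y; rewrite mxE.
Qed.

Lemma derive_mulmx m n p (P : V -> 'M[R]_(m, n)) (Q : V -> 'M[R]_(n, p)) x v :
  differentiable P x -> differentiable Q x ->
  'D_v (fun y => P y *m Q y) x = 'D_v P x *m Q x + P x *m 'D_v Q x.
Proof.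
move=> dP dQ; apply/matrixP => i j.
rewrite derive_entry; last exact: differentiable_mulmx.
rewrite (_ : (fun y => _) = \sum_(k < n) (fun y => P y i k * Q y k j)); last first.
  by apply/funext => y; rewrite fct_sumE mxE.
have dPe k := @diff_derivable _ _ _ _ _ v (differentiable_entry i k dP).
have dQe k := @diff_derivable _ _ _ _ _ v (differentiable_entry k j dQ).
rewrite derive_sum; last by move=> k; apply: derivableM.
rewrite !mxE -big_split/=; apply: eq_bigr => k _.
rewrite deriveM// !derive_entry//= addrC; congr (_ + _).
by rewrite mulrC.
Qed.

Lemma derive_comp (W W' : normedModType R) (f : V -> W) (F : W -> W') x v :
  differentiable f x -> differentiable F (f x) ->
  'D_v (fun y => F (f y)) x = 'D_('D_v f x) F (f x).
Proof.
move=> df dF; rewrite deriveE; last exact: (@differentiable_comp _ _ _ _ f F).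
by rewrite (deriveE _ dF) (deriveE _ df) (diff_comp df dF).
Qed.

Lemma derive_eq_open (W : normedModType R) (U : set V) (f h : V -> W) x v :
  open U -> U x -> (forall y, U y -> f y = h y) -> 'D_v f x = 'D_v h x.
Proof.
move=> Uo Ux fh; apply: near_eq_derive.
by have := open_nbhs_nbhs (conj Uo Ux); apply: filterS => y; exact: fh.
Qed.

Lemma differentiable_eq_open (W : normedModType R) (U : set V) (f h : V -> W) x :
  open U -> U x -> (forall y, U y -> f y = h y) ->
  differentiable f x -> differentiable h x.
Proof.
move=> Uo Ux fh df.
have ho : h \o shift x = cst (h x) + 'd f x +o_ (0 : V) id.
  apply/eqaddoP => e e0.
  have /eqaddoP/(_ e e0) := diff_locally df.
  have Un : \forall k \near (0 : V), U (k + x).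
    have : \forall y \near x, U y by exact: open_nbhs_nbhs.
    by rewrite (near_shift (0 : V)) subr0.
  apply: filterS2 Un => k Uk.
  by rewrite !fctE /= fh// fh.
have dc : continuous ('d f x) by exact: diff_continuous.
by apply/diff_locallyP; rewrite (diff_unique dc ho).
Qed.

End MatrixCalculus.

(** * Closure properties of smooth functions *)

(** Iterated derivatives of a product or of a composite have no simple closed
    form.  Peeling off the innermost derivative, D_v f, instead of the outermost
    one makes induction on the order work: D_v of a product or of a composite is
    a sum of products of functions of lower order. *)
Fixpoint diff_order (R : realType) (V W : normedModType R) (n : nat)
    (U : set V) (f : V -> W) : Prop :=
  (forall x, U x -> differentiable f x) /\
  (if n is n'.+1 then forall v, diff_order n' U ('D_v f) else True).

Section Smooth.
Variables (R : realType) (V : normedModType R) (U : set V).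
Hypothesis U_open : open U.

Lemma diff_orderW (W : normedModType R) n (f : V -> W) :
  diff_order n.+1 U f -> diff_order n U f.
Proof.
elim: n f => [|n IH] f /=; first by case.
by move=> [df Df]; split=> // v; apply: IH; exact: Df.
Qed.

Lemma smooth_on_derive (W : normedModType R) (f : V -> W) v :
  smooth_on U f -> smooth_on U ('D_v f).
Proof.
move=> sf vs x Ux.
have -> : iter_derive vs ('D_v f) = iter_derive (rcons vs v) f.
  by elim: vs {Ux} => //= w vs ->.
exact: sf.
Qed.

Lemma smooth_on_diff_order (W : normedModType R) (f : V -> W) :
  smooth_on U f <-> forall n, diff_order n U f.
Proof.
split=> [sf n|Df vs x Ux].
  elim: n f sf => [|n IH] f sf /=; split => //; try exact: (sf [::]).
  by move=> v; apply: IH; exact: smooth_on_derive.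
suff : diff_order 0 U (iter_derive vs f) by case=> + _; apply.
have /(_ 0%N) : forall n, diff_order n U (iter_derive vs f); last by [].
elim: vs => //= v vs IH n.
by have [_] := IH n.+1; apply.
Qed.

Lemma diff_order_eq (W : normedModType R) n (f h : V -> W) :
  (forall x, U x -> f x = h x) -> diff_order n U f -> diff_order n U h.
Proof.
elim: n f h => [|n IH] f h fh [df Df]; split=> //.
- by move=> x Ux; exact: differentiable_eq_open U_open Ux fh (df x Ux).
- by move=> x Ux; exact: differentiable_eq_open U_open Ux fh (df x Ux).
- move=> v; apply: IH (Df v) => x Ux.
  exact: derive_eq_open U_open Ux fh.
Qed.

Lemma diff_order_cst (W : normedModType R) n (a : W) :
  diff_order n U (fun=> a : W).
Proof.
elim: n a => [|n IH] a; split=> // v.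
by apply: diff_order_eq (IH 0) => x _; rewrite derive_cst.
Qed.

Lemma diff_orderD n (f h : V -> R) :
  diff_order n U f -> diff_order n U h ->
  diff_order n U (fun x => f x + h x).
Proof.
elim: n f h => [|n IH] f h [df Df] [dh Dh]; split=> //.
- by move=> x Ux; apply: differentiableD; [exact: df|exact: dh].
- by move=> x Ux; apply: differentiableD; [exact: df|exact: dh].
- move=> v; apply: diff_order_eq (IH _ _ (Df v) (Dh v)) => x Ux.
  by rewrite deriveD//; apply: diff_derivable; [exact: df|exact: dh].
Qed.

Lemma diff_order_sum n k (f : 'I_k -> V -> R) :
  (forall i, diff_order n U (f i)) ->
  diff_order n U (fun x => \sum_(i < k) f i x).
Proof.
elim: k f => [|k IH] f Df.
  by apply: diff_order_eq (diff_order_cst n (0 : R)) => x _; rewrite big_ord0.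
apply: diff_order_eq (diff_orderD (IH _ (fun i => Df (widen_ord (leqnSn k) i)))
  (Df ord_max)) => x _.
by rewrite big_ord_recr.
Qed.

Lemma diff_orderM n (f h : V -> R) :
  diff_order n U f -> diff_order n U h ->
  diff_order n U (fun x => f x * h x).
Proof.
elim: n f h => [|n IH] f h Hf Hh; split=> //.
- by move=> x Ux; apply: differentiableM;
    [exact: (proj1 Hf)|exact: (proj1 Hh)].
- by move=> x Ux; apply: differentiableM;
    [exact: (proj1 Hf)|exact: (proj1 Hh)].
- move=> v; have [df Df] := Hf; have [dh Dh] := Hh.
  apply: diff_order_eq (diff_orderD (IH _ _ (diff_orderW Hf) (Dh v))
    (IH _ _ (diff_orderW Hh) (Df v))) => x Ux.
  by rewrite deriveM//; apply: diff_derivable; [exact: df|exact: dh].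
Qed.

Lemma diff_order_mx n k l (M : V -> 'M[R]_(k, l)) :
  diff_order n U M <-> forall i j, diff_order n U (fun x => M x i j).
Proof.
elim: n M => [|n IH] M; split=> HM.
- by move=> i j; split=> // x Ux; apply: differentiable_entry; exact: (proj1 HM).
- by split=> // x Ux; apply: differentiable_mx => i j; exact: (proj1 (HM i j)).
- move=> i j; have [dM DM] := HM.
  split=> [x Ux|v]; first by apply: differentiable_entry; exact: dM.
  apply: diff_order_eq (proj1 (IH _) (DM v) i j) => x Ux.
  by rewrite derive_entry//; exact: dM.
- have dM x : U x -> differentiable M x.
    by move=> Ux; apply: differentiable_mx => i j; exact: (proj1 (HM i j)).
  split=> // v; apply/IH => i j.
  apply: diff_order_eq (proj2 (HM i j) v) => x Ux.
  by rewrite derive_entry//; exact: dM.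
Qed.

Lemma diff_order_entry n k l (M : V -> 'M[R]_(k, l)) i j :
  diff_order n U M -> diff_order n U (fun x => M x i j).
Proof. by move=> /diff_order_mx; apply. Qed.

End Smooth.

Section SmoothComposition.
Variables (R : realType) (V : normedModType R) (m : nat).
Variables (U : set V) (U' : set 'rV[R]_m) (f : V -> 'rV[R]_m).
Hypotheses (U_open : open U) (fU : forall x, U x -> U' (f x)).

Lemma derive_coordinates (F : 'rV[R]_m -> R) x u :
  differentiable F x ->
  'D_u F x = \sum_(i < m) u 0 i * 'D_(delta_mx 0 i) F x.
Proof.
move=> dF; rewrite deriveE// {1}(row_sum_delta u) linear_sum.
by apply: eq_bigr => i _; rewrite linearZ deriveE.
Qed.

(** Chain rule in coordinates: D_v (F o f) is the sum of the (D_v f)_i times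
    D_(e_i) F o f, to which the induction hypothesis and the stability under
    products apply. *)
Lemma diff_order_compR n (F : 'rV[R]_m -> R) :
  diff_order n U f -> diff_order n U' F -> diff_order n U (fun x => F (f x)).
Proof.
have dc (G : 'rV[R]_m -> R) : (forall x, U x -> differentiable f x) ->
    (forall x, U' x -> differentiable G x) ->
    forall x, U x -> differentiable (fun x => G (f x)) x.
  move=> df dG x Ux; apply: (@differentiable_comp _ _ _ _ f G); first exact: df.
  by apply: dG; exact: fU.
elim: n F => [|n IH] F Hf HF.
  by split=> //; apply: dc; [exact: (proj1 Hf)|exact: (proj1 HF)].
have [df Df] := Hf; have [dF DF] := HF.
split; first exact: dc.
move=> v; apply: (@diff_order_eq _ _ _ U_open _ _
    (fun x => \sum_(i < m) 'D_v f x 0 i * 'D_(delta_mx 0 i) F (f x))).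
  move=> x Ux.
  rewrite (@derive_comp _ _ _ _ f F); [|exact: df|by apply: dF; exact: fU].
  by rewrite [RHS]derive_coordinates//; apply: dF; exact: fU.
apply: diff_order_sum => // i; apply: diff_orderM => //.
  by apply: diff_order_entry => //; exact: Df.
by apply: (IH ('D_(delta_mx 0 i) F)); [exact: diff_orderW|exact: DF].
Qed.

Lemma smooth_on_comp k l (F : 'rV[R]_m -> 'M[R]_(k, l)) :
  open U' -> smooth_on U f -> smooth_on U' F -> smooth_on U (fun x => F (f x)).
Proof.
move=> U'o /smooth_on_diff_order sf /smooth_on_diff_order sF.
apply/smooth_on_diff_order => n; apply/(diff_order_mx U_open) => i j.
by apply: (@diff_order_compR n (fun y => F y i j)) => //;
  apply: diff_order_entry.
Qed.

End SmoothComposition.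

Section SmoothMatrix.
Variables (R : realType) (V : normedModType R) (U : set V).
Hypothesis U_open : open U.

Lemma smooth_on_cst (W : normedModType R) (a : W) : smooth_on U (fun=> a).
Proof. by apply/smooth_on_diff_order => n; exact: diff_order_cst. Qed.

Lemma smooth_on_eq (W : normedModType R) (f h : V -> W) :
  (forall x, U x -> f x = h x) -> smooth_on U f -> smooth_on U h.
Proof.
move=> fh /smooth_on_diff_order sf.
by apply/smooth_on_diff_order => n; exact: diff_order_eq fh (sf n).
Qed.

Lemma smooth_on_mulmx k l p (P : V -> 'M[R]_(k, l)) (Q : V -> 'M[R]_(l, p)) :
  smooth_on U P -> smooth_on U Q -> smooth_on U (fun x => P x *m Q x).
Proof.
move=> /smooth_on_diff_order sP /smooth_on_diff_order sQ.
apply/smooth_on_diff_order => n; apply/(diff_order_mx U_open) => i j.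
apply: (@diff_order_eq _ _ _ U_open _ _ (fun x => \sum_(r < l) P x i r * Q x r j)).
  by move=> x _; rewrite mxE.
by apply: diff_order_sum => // r; apply: diff_orderM => //;
  apply: diff_order_entry.
Qed.

Lemma smooth_onD k l (P Q : V -> 'M[R]_(k, l)) :
  smooth_on U P -> smooth_on U Q -> smooth_on U (fun x => P x + Q x).
Proof.
move=> /smooth_on_diff_order sP /smooth_on_diff_order sQ.
apply/smooth_on_diff_order => n; apply/(diff_order_mx U_open) => i j.
apply: (@diff_order_eq _ _ _ U_open _ _ (fun x => P x i j + Q x i j)).
  by move=> x _; rewrite mxE.
by apply: diff_orderD => //; exact: diff_order_entry.
Qed.

Lemma smooth_onZ k l (a : R) (P : V -> 'M[R]_(k, l)) :
  smooth_on U P -> smooth_on U (fun x => a *: P x).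
Proof.
move=> sP; apply: (@smooth_on_eq _ (fun x => a%:M *m P x)).
  by move=> x _; rewrite mul_scalar_mx.
by apply: smooth_on_mulmx => //; exact: smooth_on_cst.
Qed.

End SmoothMatrix.

(** * Symmetry of second derivatives *)

Section Schwarz.
Variables (R : realType) (V : normedModType R) (U : set V) (f : V -> R).
Hypotheses (U_open : open U) (f_smooth : smooth_on U f).

Lemma is_derive_line (a w : V) (s : R) :
  U (s *: w + a) ->
  is_derive s 1 (fun r : R => f (r *: w + a)) ('D_w f (s *: w + a)).
Proof.
move=> Us; have df : differentiable f (s *: w + a) by exact: (f_smooth [::] Us).
have dl : is_diff s (fun r : R => r *: w + a) (fun r => r *: w).
  apply: is_diff_eq; apply/funext => r; by rewrite fctE /= addr0.
have dfl : differentiable (fun r : R => f (r *: w + a)) s.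
  apply: (@differentiable_comp _ _ _ _ (fun r : R => r *: w + a) f) => //.
apply: DeriveDef; first exact: diff_derivable.
rewrite (@derive_comp _ _ _ _ (fun r : R => r *: w + a) f)//.
by rewrite [X in 'D_X f _]deriveE// diff_val scale1r.
Qed.

(** The mean value theorem applied to s |-> f(x + s h u + h v) - f(x + s h u)
    turns the second difference into h times an increment of D_u f, and the
    differentiability of D_u f at x evaluates that increment up to o(h).  The
    left-hand side being symmetric in u and v, so is the limit.

    The value of D_v (D_u f) x is carried by the variable a so that the two
    second derivatives compared in derive_swap are never unified with each
    other, which would unfold the limits that define them. *)
Lemma second_difference (x u v : V) (a e : R) : 'D_v ('D_u f) x = a ->
  U x -> 0 < e ->
  exists2 d, 0 < d & forall h, 0 < h < d ->
    `|f (h *: u + (h *: v + x)) - f (h *: u + x) - f (h *: v + x) + f x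
      - h ^+ 2 * a| <= e * h ^+ 2.
Proof.
move=> Ea Ux e0; pose M := `|u| + `|v| + 1.
have M0 : 0 < M by rewrite ltr_wpDl// addr_ge0.
have e'0 : 0 < e / (2 * M) by rewrite divr_gt0// mulr_gt0.
have dg : differentiable ('D_u f) x by exact: (f_smooth [:: u] Ux).
have /eqaddoP/(_ _ e'0) := diff_locally dg.
have : \forall k \near (0 : V), U (k + x).
  have : \forall y \near x, U y by exact: open_nbhs_nbhs.
  by rewrite (near_shift (0 : V)) subr0.
move=> nU ng; have [d0 /= d00 Hd] := (nbhs_ballP _ _).1 (filterI nU ng).
exists (d0 / M) => [|h /andP[h0]]; first by rewrite divr_gt0.
rewrite ltr_pdivlMr// => hM.
(* only w = v and w = 0 are used: the two ends of the increment of D_u f *)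
have small (s : R) (w : V) : 0 <= s <= 1 -> (`|w| <= `|v|) ->
    `|s *: (h *: u) + h *: w| <= h * M.
  move=> /andP[s0 s1] wv; apply: le_trans (ler_normD _ _) _.
  rewrite !normrZ (gtr0_norm h0) (ger0_norm s0) mulrCA -mulrDr ler_pM2l//.
  rewrite /M -addrA lerD//; last by rewrite (le_trans wv)// lerDl.
  by rewrite ler_piMl.
have sv0 : `|v| <= `|v| by [].
have s00 : `|0 : V| <= `|v| by rewrite normr0.
have inb (k : V) : `|k| <= h * M -> ball (0 : V) d0 k.
  by move=> kh; rewrite -ball_normE /ball_ /= sub0r normrN (le_lt_trans kh).
have inU (s : R) (w : V) : 0 <= s <= 1 -> `|w| <= `|v| ->
    U (s *: (h *: u) + (h *: w + x)).
  by move=> s01 wv; rewrite addrA; have [] := Hd _ (inb _ (small _ _ s01 wv)).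
have bound (s : R) (w : V) : 0 <= s <= 1 -> `|w| <= `|v| ->
    `|'D_u f (s *: (h *: u) + (h *: w + x)) - 'D_u f x
      - 'd ('D_u f) x (s *: (h *: u) + h *: w)| <= e / (2 * M) * (h * M).
  move=> s01 wv; have [_] := Hd _ (inb _ (small _ _ s01 wv)).
  rewrite !fctE /= opprD !addrA => /le_trans; apply.
  by rewrite ler_pM2l//; exact: small.
pose F (s : R) : R := f (s *: (h *: u) + (h *: v + x)) - f (s *: (h *: u) + (h *: 0 + x)).
pose dF (s : R) : R := 'D_(h *: u) f (s *: (h *: u) + (h *: v + x))
           - 'D_(h *: u) f (s *: (h *: u) + (h *: 0 + x)).
have dFP (s : R) : 0 <= s <= 1 -> is_derive s 1 F (dF s).
  by move=> s01; apply: is_deriveB; apply: is_derive_line; exact: inU.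
have [||c] := @MVT_segment R F dF 0 1 ler01.
- by move=> s /[!in_itv]/= /andP[s0 s1]; apply: dFP; rewrite !ltW.
- apply: derivable_within_continuous => s /[!in_itv]/= s01.
  by have [] := dFP s s01.
rewrite in_itv/= => c01.
have Dh (w : V) : `|w| <= `|v| -> 'D_(h *: u) f (c *: (h *: u) + (h *: w + x)) =
    h * 'D_u f (c *: (h *: u) + (h *: w + x)).
  move=> wv; have df := f_smooth [::] (inU _ _ c01 wv).
  by rewrite deriveE// linearZ -deriveE.
rewrite /F /dF !Dh// !scale1r !scale0r !add0r !scaler0 !add0r subr0 mulr1 => E.
have -> : f (h *: u + (h *: v + x)) - f (h *: u + x) - f (h *: v + x) + f x =
  f (h *: u + (h *: v + x)) - f (h *: u + x) - (f (h *: v + x) - f x) by ring.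
have b1 := bound c v c01 sv0; have b2 := bound c 0 c01 s00.
rewrite scaler0 addr0 add0r in b2.
rewrite E -mulrBr expr2 -mulrA -mulrBr normrM (gtr0_norm h0) mulrCA ler_pM2l//.
have eM : e / (2 * M) * (h * M) = e * h / 2 by field; rewrite gt_eqF.
rewrite eM in b1 b2.
have dk : 'd ('D_u f) x (c *: (h *: u) + h *: v) =
    'd ('D_u f) x (c *: (h *: u)) + h * a.
  by rewrite -Ea (deriveE _ dg) linearD [X in _ + X = _]linearZ.
rewrite dk in b1; move: b1 b2.
move: ('D_u f (c *: _ + _)) ('D_u f (c *: _ + _)) ('D_u f x)
  ('d _ _ _) => p1 p2 p3 p4.
rewrite !ler_norml => /andP[? ?] /andP[? ?].
apply/andP; split; lra.
Qed.

End Schwarz.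

(** Schwarz's theorem. *)
Lemma derive_swap (R : realType) (V : normedModType R) (U : set V)
    (f : V -> R) (x u v : V) :
  open U -> smooth_on U f -> U x -> 'D_v ('D_u f) x = 'D_u ('D_v f) x.
Proof.
move=> Uo sf Ux; suff ab_eq a b :
  'D_v ('D_u f) x = a -> 'D_u ('D_v f) x = b -> a = b by exact: ab_eq.
move=> Ea Eb; apply/eqP/negPn/negP => neq.
have ab : 0 < `|a - b| by rewrite normr_gt0 subr_eq0.
have e0 : 0 < `|a - b| / 4 by rewrite divr_gt0.
have [d1 d10 H1] := second_difference Uo sf Ea Ux e0.
have [d2 d20 H2] := second_difference Uo sf Eb Ux e0.
pose h := Num.min d1 d2 / 2.
have hm : 0 < Num.min d1 d2 by rewrite lt_min d10.
have h0 : 0 < h by rewrite divr_gt0.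
have hd : h < Num.min d1 d2 by rewrite ltr_pdivrMr// ltr_pMr// ltr1n.
have := H1 h; have := H2 h.
move: hd; rewrite lt_min h0 => /andP[-> ->] /(_ isT) h2 /(_ isT) h1.
have hh0 : 0 < h ^+ 2 by rewrite exprn_gt0.
have swap : h *: v + (h *: u + x) = h *: u + (h *: v + x) by rewrite addrCA.
rewrite swap in h2.
rewrite [X in `|X + _ - _|]addrAC in h2.
move: h1 h2; move: (f _ - f _ - f _ + f x) => T h1 h2.
have : h ^+ 2 * `|a - b| <= `|a - b| / 2 * h ^+ 2.
  rewrite -(gtr0_norm hh0) -normrM mulrBr.
  have -> : h ^+ 2 * a - h ^+ 2 * b = (T - h ^+ 2 * b) - (T - h ^+ 2 * a).
    by ring.
  apply: le_trans (ler_normB _ _) _.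
  apply: le_trans (lerD h2 h1) _.
  rewrite (gtr0_norm hh0) -mulrDl ler_pM2r//.
  move: (`|a - b|) => r; clear; lra.
rewrite mulrC ler_pM2r// => /le_lt_trans.
by move=> /(_ `|a - b|); rewrite ltr_pdivrMr// ltr_pMr// ltr1n ltxx => /(_ isT).
Qed.

(** * The linear algebra of the Sasakian condition *)

(** The section is stated for an abstract tangent space: a(u, v, w) stands for
    g((nabla_u phi) v, w) and b(u, v) for g(nabla_u xi, v).  The hypotheses on a
    and b are what is left at a point of, in order, the skewness of phi
    (a_skew), d(d eta) = 0 (a_cyclic), normality (a_normal), the contact
    condition (b_contact), |xi| = 1 (b_xi) and phi xi = 0 (a_xi). *)
Section SasakianAlgebra.
Variables (R : realFieldType) (V : lmodType R).
Variables (phi : V -> V) (xi : V) (eta : V -> R) (g : V -> V -> R).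
Variables (a : V -> V -> V -> R) (b : V -> V -> R).
Hypothesis phi_sqr : forall u, phi (phi u) = - u + eta u *: xi.
Hypothesis eta_xi : eta xi = 1.
Hypothesis phi_xi : phi xi = 0.
Hypothesis eta_phi : forall u, eta (phi u) = 0.
Hypothesis g_sym : forall u v, g u v = g v u.
Hypothesis g_linear : forall k u u' v, g (k *: u + u') v = k * g u v + g u' v.
Hypothesis g_phi : forall u v, g (phi u) v = - g u (phi v).
Hypothesis g_xi : forall u, g u xi = eta u.
Hypothesis a_linear : forall k u u' v w,
  a (k *: u + u') v w = k * a u v w + a u' v w.
Hypothesis b_linear : forall k w u u', b w (k *: u + u') = k * b w u + b w u'.
Hypothesis a_skew : forall u v w, a u v w = - a u w v.
Hypothesis a_cyclic : forall u v w, a u v w + a v w u + a w u v = 0.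
Hypothesis a_normal : forall u v w,
  a (phi u) v w - a (phi v) u w - a v u (phi w) + a u v (phi w) =
  - (2 * g u (phi v)) * eta w.
Hypothesis b_contact : forall u v, b u v - b v u = 2 * g u (phi v).
Hypothesis b_xi : forall u, b u xi = 0.
Hypothesis a_xi : forall u w, a u xi w = b u (phi w).

(** The defect of the expected formula: it satisfies the same equations as a,
    with zero right-hand sides. *)
Let t u v w := a u v w - (g u v * eta w - eta v * g u w).

Let phi_skew u v : g v (phi u) = - g u (phi v).
Proof. by rewrite g_sym g_phi. Qed.

Let t_skew u v w : t u v w = - t u w v.
Proof. by rewrite /t (a_skew u v w); ring. Qed.

Let t_cyclic u v w : t u v w + t v w u + t w u v = 0.
Proof.
rewrite -[RHS](a_cyclic u v w) /t (g_sym w u) (g_sym w v) (g_sym v u); ring.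
Qed.

Let t_normal u v w :
  t (phi u) v w - t (phi v) u w - t v u (phi w) + t u v (phi w) = 0.
Proof.
have := a_normal u v w; rewrite /t !eta_phi !g_phi (phi_skew u v) (g_sym v u).
move=> e; rewrite -[RHS](subrr (- (2 * g u (phi v)) * eta w)) -{1}e; ring.
Qed.

(** By the cyclic identity, normality becomes
    c(x, y, z) + c(y, z, x) - c(z, x, y) = 0 for c(x, y, z) = t(phi x, y, z);
    adding a cyclic permutation of this leaves 2 c(y, z, x) = 0. *)
Let t_phi u v w : t (phi u) v w = 0.
Proof.
have tE x y z : t (phi x) y z + t (phi y) z x - t (phi z) x y = 0.
  have e1 := t_normal x y z; have e2 := t_cyclic x y (phi z).
  have e3 := t_skew (phi y) x z; have e4 := t_skew y x (phi z); lra.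
have e1 := tE u v w; have e2 := tE w u v; lra.
Qed.

Let t_linear k u u' v w : t (k *: u + u') v w = k * t u v w + t u' v w.
Proof. rewrite /t a_linear !g_linear; ring. Qed.

(** Only the component of u along xi counts, since u = eta(u) xi - phi (phi u). *)
Let t_eta u v w : t u v w = eta u * t xi v w.
Proof.
have : t (phi (phi u)) v w = 0 by exact: t_phi.
rewrite phi_sqr addrC t_linear => e.
have : t (- u) v w = - t u v w.
  have := t_linear (-1) u (- u) v w; rewrite scaleN1r.
  have := t_linear (-1) 0 0 v w; rewrite scaleN1r oppr0 addr0.
  have := t_linear 1 u (- u) v w; rewrite scale1r subrr; lra.
by move=> e2; lra.
Qed.

Let b_xi_l v : b xi v = 0.
Proof.
have := b_contact xi v; rewrite b_xi -(opprK (g xi _)) -g_phi phi_xi.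
have : g 0 v = 0 by have := g_linear 1 0 0 v; rewrite scaler0 addr0; lra.
by move=> ->; lra.
Qed.

(** The integral curves of xi are geodesics (b_xi_l), which gives
    t(xi, xi, .) = 0; the cyclic identity at (xi, v, w) does the rest. *)
Let t_xi v w : t xi v w = 0.
Proof.
have t0 z : t xi xi z = 0.
  by rewrite /t a_xi b_xi_l g_xi eta_xi (g_sym xi z) g_xi; ring.
have := t_cyclic xi v w; rewrite (t_eta v) (t_eta w) t0 (t_skew xi w) t0; lra.
Qed.

Lemma sasakian_tensors :
  (forall u v w, a u v w = g u v * eta w - eta v * g u w) /\
  (forall u v, b u v = - g (phi u) v).
Proof.
have aE u v w : a u v w = g u v * eta w - eta v * g u w.
  by apply/subr0_eq; rewrite -[LHS]/(t u v w) t_eta t_xi mulr0.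
split=> // u v.
have := a_xi u (phi v); rewrite aE g_xi eta_phi eta_xi g_phi.
rewrite phi_sqr [- v + _]addrC b_linear b_xi.
have : b u (- v) = - b u v.
  have := b_linear (-1) u 0 0; rewrite scaleN1r oppr0 addr0.
  have := b_linear 1 u v (- v); rewrite scale1r subrr; lra.
by move=> ->; lra.
Qed.

End SasakianAlgebra.

(** * Parallelism of the structure tensors for the Tanaka-Webster connection *)

Section PointwiseTensors.
Variables (R : realType) (m : nat) (N : smooth_manifold R m).
Variables (eta : form_components N) (phi g : matrix_components N).
Variables (c : chart_index N) (x : 'rV[R]_m).

Lemma eval_formD u v :
  eval_form eta c x (u + v) = eval_form eta c x u + eval_form eta c x v.
Proof. by rewrite /eval_form mulmxDl mxE. Qed.

Lemma eval_formZ a u : eval_form eta c x (a *: u) = a * eval_form eta c x u.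
Proof. by rewrite /eval_form -scalemxAl mxE. Qed.

Lemma eval_endoD u v :
  eval_endo phi c x (u + v) = eval_endo phi c x u + eval_endo phi c x v.
Proof. exact: mulmxDl. Qed.

Lemma eval_endoN u : eval_endo phi c x (- u) = - eval_endo phi c x u.
Proof. exact: mulNmx. Qed.

Lemma eval_endoZ a u : eval_endo phi c x (a *: u) = a *: eval_endo phi c x u.
Proof. by rewrite /eval_endo scalemxAl. Qed.

Lemma eval_metricDl u u' v : eval_metric g c x (u + u') v =
  eval_metric g c x u v + eval_metric g c x u' v.
Proof. by rewrite /eval_metric !mulmxDl mxE. Qed.

Lemma eval_metricDr u v v' : eval_metric g c x u (v + v') =
  eval_metric g c x u v + eval_metric g c x u v'.
Proof. by rewrite /eval_metric linearD mulmxDr mxE. Qed.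

Lemma eval_metricZl a u v :
  eval_metric g c x (a *: u) v = a * eval_metric g c x u v.
Proof. by rewrite /eval_metric -!scalemxAl mxE. Qed.

Lemma eval_metricZr a u v :
  eval_metric g c x u (a *: v) = a * eval_metric g c x u v.
Proof. by rewrite /eval_metric linearZ /= -scalemxAr mxE. Qed.

Lemma eval_metricNl u v : eval_metric g c x (- u) v = - eval_metric g c x u v.
Proof. by rewrite -scaleN1r eval_metricZl mulN1r. Qed.

Lemma eval_metricNr u v : eval_metric g c x u (- v) = - eval_metric g c x u v.
Proof. by rewrite -scaleN1r eval_metricZr mulN1r. Qed.

Definition eval_metricE := (eval_metricDl, eval_metricDr, eval_metricZl,
  eval_metricZr, eval_metricNl, eval_metricNr).

Lemma eval_metric_eq0 u : is_riemannian_metric g -> cod c x ->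
  eval_metric g c x u u = 0 -> u = 0.
Proof.
move=> [_ _ _ gpos] cx u0; apply/eqP/negPn/negP => un0.
by have := gpos c x u cx un0; rewrite u0 ltxx.
Qed.

Lemma eval_metric_inj u v : is_riemannian_metric g -> cod c x ->
  (forall w, eval_metric g c x u w = eval_metric g c x v w) -> u = v.
Proof.
move=> gR cx uv; apply/subr0_eq/eval_metric_eq0 => //.
by rewrite eval_metricDl eval_metricNl uv subrr.
Qed.

End PointwiseTensors.

(** These two tensors are locked because rewriting with the bilinearity of the
   metric would otherwise see through them and distribute over their terms. *)
HB.lock Definition nabla_field (R : realType) (m : nat)
    (N : smooth_manifold R m) (nabla : connection_components N)
    (X : vector_components N) (c : chart_index N) (x u : 'rV[R]_m) : 'rV[R]_m :=
  'D_u (X c) x + nabla c x u (X c x).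

HB.lock Definition nabla_endo (R : realType) (m : nat)
    (N : smooth_manifold R m) (nabla : connection_components N)
    (phi : matrix_components N) (c : chart_index N) (x u v : 'rV[R]_m)
    : 'rV[R]_m :=
  'D_u (fun y => eval_endo phi c y v) x
  + nabla c x u (eval_endo phi c x v) - eval_endo phi c x (nabla c x u v).

Section Chart.
Variables (R : realType) (m : nat) (N : smooth_manifold R m).
Variables (phi : matrix_components N) (xi : vector_components N).
Variables (eta : form_components N) (g : matrix_components N).
Variables (nabla : connection_components N).
Hypothesis sas : sasakian phi xi eta g.
Hypothesis lc : levi_civita g nabla.
Variables (c : chart_index N).

Let U := cod c.
Let U_open : open U. Proof. exact: chart_open. Qed.
Let acm : almost_contact_metric phi xi eta g := proj1 (proj1 sas).
Let xi_smooth : smooth_on U (xi c) := proj1 (xi_field acm) c.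
Let eta_smooth : smooth_on U (eta c) := proj1 (eta_form acm) c.
Let phi_smooth : smooth_on U (phi c) := proj1 (phi_field acm) c.

Let cst_smooth (u : 'rV[R]_m) : smooth_on U (fun=> u).
Proof. exact: smooth_on_cst. Qed.

Let phiu_smooth (u : 'rV[R]_m) : smooth_on U (fun y => eval_endo phi c y u).
Proof. by apply: smooth_on_mulmx => //; exact: smooth_on_cst. Qed.

Lemma metric_sym x u v : U x -> eval_metric g c x u v = eval_metric g c x v u.
Proof. by case: (g_riemannian acm) => _ _ + _; apply. Qed.

(** Apply g_phi to (phi u, v) and use phi (phi u) = - u + eta(u) xi. *)
Lemma phi_skew x u v : U x -> eval_metric g c x (eval_endo phi c x u) v =
  - eval_metric g c x u (eval_endo phi c x v).
Proof.
move=> Ux; rewrite (g_phi acm)// (phi_sqr acm)// (eta_phi acm)// mul0r addr0.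
rewrite eval_metricDl eval_metricNl eval_metricZl (metric_sym (xi c x))//.
by rewrite (g_xi acm)// (eta_phi acm)// mulr0 addr0.
Qed.

Lemma nabla_linl x a u u' v : U x ->
  nabla c x (a *: u + u') v = a *: nabla c x u v + nabla c x u' v.
Proof. by move=> Ux; case: lc => -[+ _ _ _] _ _; apply. Qed.

Lemma nabla_linr x a u v v' : U x ->
  nabla c x u (a *: v + v') = a *: nabla c x u v + nabla c x u v'.
Proof. by move=> Ux; case: lc => -[_ + _ _] _ _; apply. Qed.

Lemma nabla_0r x u : U x -> nabla c x u 0 = 0.
Proof.
move=> Ux; have := nabla_linr (-1) u 0 0 Ux.
by rewrite scaler0 addr0 scaleN1r addNr.
Qed.

Lemma nablaNr x u v : U x -> nabla c x u (- v) = - nabla c x u v.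
Proof.
move=> Ux; have := nabla_linr (-1) u v 0 Ux.
by rewrite nabla_0r// !addr0 !scaleN1r.
Qed.

(** Torsion-freeness tested on two constant fields, whose bracket vanishes. *)
Lemma nabla_sym x u v : U x -> nabla c x u v = nabla c x v u.
Proof.
move=> Ux; have [_ /(_ c _ _ (cst_smooth u) (cst_smooth v) x Ux)] := lc.
rewrite /cov_deriv /lie_bracket !derive_cst !add0r oppr0 => + _.
exact: subr0_eq.
Qed.

Lemma nabla_metric x u (Y Z : 'rV[R]_m -> 'rV[R]_m) : U x ->
  smooth_on U Y -> smooth_on U Z ->
  'D_u (fun y => eval_metric g c y (Y y) (Z y)) x =
  eval_metric g c x ('D_u Y x + nabla c x u (Y x)) (Z x) +
  eval_metric g c x (Y x) ('D_u Z x + nabla c x u (Z x)).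
Proof.
move=> Ux sY sZ; have [_ _ /(_ c _ _ _ (cst_smooth u) sY sZ x Ux)] := lc.
by [].
Qed.

Local Notation nabla_xi := (nabla_field nabla xi c).
Local Notation nabla_phi := (nabla_endo nabla phi c).

Let derive_phi x u v : U x -> 
  'D_u (fun y => eval_endo phi c y v) x = v *m 'D_u (phi c) x.
Proof.
move=> Ux; rewrite (derive_mulmx (P := fun=> v)) ?derive_cst ?mul0mx ?add0r//.
exact: (phi_smooth [::] Ux).
Qed.

Let derive_lin (W : normedModType R) (f : 'rV[R]_m -> W) x a u u' :
  differentiable f x -> 'D_(a *: u + u') f x = a *: 'D_u f x + 'D_u' f x.
Proof. by move=> df; rewrite !deriveE// linearP. Qed.

Let nabla_phi_linear x a u u' v : U x ->
  nabla_phi x (a *: u + u') v = a *: nabla_phi x u v + nabla_phi x u' v.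
Proof.
move=> Ux; rewrite nabla_endo.unlock nabla_linl// nabla_linl// derive_lin;
  last exact: (phiu_smooth _ [::] Ux).
rewrite eval_endoD eval_endoZ opprD [X in X + _ = _]addrACA [LHS]addrACA.
by rewrite !scalerDr scalerN.
Qed.

Let nabla_phiN x u v : U x -> nabla_phi x u (- v) = - nabla_phi x u v.
Proof.
move=> Ux; rewrite nabla_endo.unlock eval_endoN !nablaNr// eval_endoN.
by rewrite !derive_phi// mulNmx !opprD.
Qed.

Let derive_metric_cst_phi x u v w : U x ->
  'D_w (fun y => eval_metric g c y u (eval_endo phi c y v)) x =
  eval_metric g c x (nabla c x w u) (eval_endo phi c x v)
  + eval_metric g c x u (nabla_phi x w v + eval_endo phi c x (nabla c x w v)).
Proof.
move=> Ux; rewrite (nabla_metric w Ux (cst_smooth u) (phiu_smooth v)).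
by rewrite (derive_cst u x w) add0r nabla_endo.unlock subrK.
Qed.

(** Differentiate phi xi = 0. *)
Let nabla_phi_reeb x u : U x ->
  nabla_phi x u (xi c x) = - eval_endo phi c x (nabla_xi x u).
Proof.
move=> Ux; rewrite nabla_endo.unlock (phi_xi acm)// nabla_0r// addr0 derive_phi//.
have : 'D_u (fun y => xi c y *m phi c y) x = 0.
  rewrite (@derive_eq_open _ _ _ U _ (fun=> 0)) ?derive_cst//.
  by move=> y Uy; exact: (phi_xi acm).
rewrite derive_mulmx; [|exact: (xi_smooth [::] Ux)|exact: (phi_smooth [::] Ux)].
rewrite addrC => /eqP; rewrite addr_eq0 => /eqP ->.
by rewrite nabla_field.unlock eval_endoD opprD.
Qed.

Let derive_phiE x u v : 'D_u (fun y => eval_endo phi c y v) x =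
  nabla_phi x u v - nabla c x u (eval_endo phi c x v)
  + eval_endo phi c x (nabla c x u v).
Proof. by rewrite nabla_endo.unlock addrAC subrK addrK. Qed.

(** Differentiate g(phi v, w) = g(v, phi (- w)); the sign is kept inside phi so
    that both sides are metric products of smooth fields. *)
Let nabla_phi_skew x u v w : U x ->
  eval_metric g c x (nabla_phi x u v) w = - eval_metric g c x (nabla_phi x u w) v.
Proof.
move=> Ux.
have e1 := derive_metric_cst_phi w v u Ux.
have e2 := derive_metric_cst_phi v (- w) u Ux.
have e3 : 'D_u (fun y => eval_metric g c y w (eval_endo phi c y v)) x =
    'D_u (fun y => eval_metric g c y v (eval_endo phi c y (- w))) x.
  apply: (derive_eq_open _ U_open Ux) => y Uy.
  by rewrite metric_sym// phi_skew// eval_endoN eval_metricNr.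
move: e1; rewrite e3 e2 nabla_phiN// nablaNr// !eval_endoN !eval_metricE.
rewrite (metric_sym w (nabla_phi x u v))// (metric_sym v (nabla_phi x u w))//.
have := phi_skew (nabla c x u v) w Ux; have := phi_skew v (nabla c x u w) Ux.
rewrite (metric_sym w (eval_endo _ _ _ _))//.
rewrite (metric_sym (nabla c x u w) (eval_endo _ _ _ _))//.
move=> e4 e5 e6; lra.
Qed.

(** Differentiate g(xi, xi) = 1. *)
Let nabla_xi_unit x u : U x -> eval_metric g c x (nabla_xi x u) (xi c x) = 0.
Proof.
move=> Ux; have := nabla_metric u Ux xi_smooth xi_smooth.
rewrite (@derive_eq_open _ _ _ U _ (fun=> 1 : R))//; last first.
  by move=> y Uy; rewrite (g_xi acm)// (eta_xi acm).
rewrite derive_cst nabla_field.unlock.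
by rewrite [X in _ = _ + X](metric_sym (xi c x))//; lra.
Qed.

Let eta_smoothR v : smooth_on U (fun y => eval_form eta c y v).
Proof.
have /smooth_on_diff_order H : smooth_on U (fun y => v *m eta c y).
  by apply: smooth_on_mulmx => //; exact: smooth_on_cst.
by apply/smooth_on_diff_order => n; apply: diff_order_entry.
Qed.

(** Differentiate eta(v) = g(v, xi). *)
Let derive_eta x u v : U x -> 'D_u (fun y => eval_form eta c y v) x =
  eval_metric g c x (nabla c x u v) (xi c x) + eval_metric g c x v (nabla_xi x u).
Proof.
move=> Ux; rewrite (@derive_eq_open _ _ _ U _
    (fun y => eval_metric g c y v (xi c y)))//; last first.
  by move=> y Uy; rewrite (g_xi acm).
rewrite (@nabla_metric _ _ (fun=> v))// (derive_cst v x u) add0r.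
by rewrite nabla_field.unlock.
Qed.

Let d_eta_contact x u v : U x ->
  2^-1 * ('D_u (fun y => eval_form eta c y v) x
     - 'D_v (fun y => eval_form eta c y u) x) =
  eval_metric g c x u (eval_endo phi c x v).
Proof.
move=> Ux; rewrite -(proj2 (proj1 sas) c _ _ (cst_smooth u) (cst_smooth v) x Ux).
rewrite /d_form /lie_bracket !derive_cst subrr.
suff -> : eval_form eta c x 0 = 0 by rewrite subr0.
by rewrite /eval_form mul0mx mxE.
Qed.

Let nabla_xi_contact x u v : U x ->
  eval_metric g c x (nabla_xi x u) v - eval_metric g c x (nabla_xi x v) u =
  2 * eval_metric g c x u (eval_endo phi c x v).
Proof.
move=> Ux; rewrite -d_eta_contact// !derive_eta// (nabla_sym v)//.
rewrite (metric_sym v)// (metric_sym u)//; lra.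
Qed.

(** The 2-form g(u, phi v) is d eta, so this is d (d eta) = 0 evaluated on
    constant fields: six second derivatives of eta that cancel in pairs. *)
Let dPhi_eq0 x u v w : U x ->
  'D_w (fun y => eval_metric g c y u (eval_endo phi c y v)) x
  + 'D_u (fun y => eval_metric g c y v (eval_endo phi c y w)) x
  + 'D_v (fun y => eval_metric g c y w (eval_endo phi c y u)) x = 0.
Proof.
move=> Ux.
pose f v y := eval_form eta c y v.
have dPhi u' v' w' :
    'D_w' (fun y => eval_metric g c y u' (eval_endo phi c y v')) x =
    2^-1 * ('D_w' ('D_u' (f v')) x - 'D_w' ('D_v' (f u')) x).
  have d1 : differentiable ('D_u' (f v')) x by exact: (eta_smoothR v' [:: u'] Ux).
  have d2 : differentiable ('D_v' (f u')) x by exact: (eta_smoothR u' [:: v'] Ux).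
  rewrite (@derive_eq_open _ _ _ U _
    (2^-1 \*: ('D_u' (f v') - 'D_v' (f u'))))//; last first.
    by move=> y Uy; rewrite -d_eta_contact.
  rewrite deriveZ; last by apply: derivableB; exact: diff_derivable.
  by rewrite deriveB//; exact: diff_derivable.
have alg (p q r p' q' r' : R) : p = p' -> q = q' -> r = r' ->
    2^-1 * (p - q) + 2^-1 * (r - p') + 2^-1 * (q' - r') = 0.
  by move=> -> -> ->; ring.
by rewrite !dPhi; apply: alg; exact: (derive_swap _ _ U_open (eta_smoothR _) Ux).
Qed.

(** In dPhi_eq0 the Christoffel terms cancel, because phi is skew and nabla is
    symmetric. *)
Let nabla_phi_cyclic x u v w : U x ->
  eval_metric g c x (nabla_phi x u v) w + eval_metric g c x (nabla_phi x v w) u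
  + eval_metric g c x (nabla_phi x w u) v = 0.
Proof.
move=> Ux; have := dPhi_eq0 u v w Ux.
rewrite !derive_metric_cst_phi// !eval_metricDr.
rewrite !(metric_sym _ (nabla_phi x _ _))//.
rewrite !(metric_sym _ (eval_endo phi c x (nabla c x _ _)))//.
rewrite !phi_skew// (nabla_sym w u)// (nabla_sym w v)// (nabla_sym v u)//.
have := nabla_phi_skew u v w Ux; have := nabla_phi_skew v w u Ux.
by have := nabla_phi_skew w u v Ux; lra.
Qed.

(** The Nijenhuis tensor of phi on constant fields, with every derivative of phi
    replaced by the covariant one: the Christoffel terms cancel since nabla is
    symmetric. *)
Let nabla_phi_normal x u v : U x ->
  nabla_phi x (eval_endo phi c x u) v - nabla_phi x (eval_endo phi c x v) u
  + eval_endo phi c x (nabla_phi x v u) - eval_endo phi c x (nabla_phi x u v) =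
  - (2 * eval_metric g c x u (eval_endo phi c x v)) *: xi c x.
Proof.
move=> Ux.
have := (proj2 sas) c _ _ (cst_smooth u) (cst_smooth v) x Ux.
rewrite (proj2 (proj1 sas) c _ _ (cst_smooth u) (cst_smooth v) x Ux) => <-.
rewrite /nijenhuis /lie_bracket !derive_cst subrr !sub0r !subr0.
have e0 : eval_endo phi c x 0 = 0 by rewrite /eval_endo mul0mx.
rewrite !e0 !add0r !derive_phiE !(eval_endoD, eval_endoN).
rewrite (nabla_sym (eval_endo phi c x v) (eval_endo phi c x u))//.
rewrite (nabla_sym v (eval_endo phi c x u))//.
rewrite (nabla_sym (eval_endo phi c x v) u)// (nabla_sym v u)//.
apply/rowP => i; rewrite !mxE; ring.
Qed.

(** The covariant derivatives of phi and xi that characterise Sasakian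
    structures. *)
Lemma sasakian_nabla x : U x ->
  (forall u v, nabla_phi x u v = eval_metric g c x u v *: xi c x
     - eval_form eta c x v *: u) /\
  (forall u, nabla_xi x u = - eval_endo phi c x u).
Proof.
move=> Ux.
have g_R := g_riemannian acm.
have glin k u u' v : eval_metric g c x (k *: u + u') v =
    k * eval_metric g c x u v + eval_metric g c x u' v.
  by rewrite eval_metricDl eval_metricZl.
have alin k u u' v w : eval_metric g c x (nabla_phi x (k *: u + u') v) w =
    k * eval_metric g c x (nabla_phi x u v) w
    + eval_metric g c x (nabla_phi x u' v) w.
  by rewrite nabla_phi_linear.
have blin k w u u' : eval_metric g c x (nabla_xi x w) (k *: u + u') =
    k * eval_metric g c x (nabla_xi x w) u
    + eval_metric g c x (nabla_xi x w) u'.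
  by rewrite eval_metricDr eval_metricZr.
have anorm u v w :
    eval_metric g c x (nabla_phi x (eval_endo phi c x u) v) w
    - eval_metric g c x (nabla_phi x (eval_endo phi c x v) u) w
    - eval_metric g c x (nabla_phi x v u) (eval_endo phi c x w)
    + eval_metric g c x (nabla_phi x u v) (eval_endo phi c x w) =
    - (2 * eval_metric g c x u (eval_endo phi c x v)) * eval_form eta c x w.
  have /(congr1 (fun z => eval_metric g c x z w)) := nabla_phi_normal u v Ux.
  rewrite !(eval_metricDl, eval_metricNl, eval_metricZl) !phi_skew//.
  by rewrite (metric_sym (xi c x))// (g_xi acm)// => <-; ring.
have axi u w : eval_metric g c x (nabla_phi x u (xi c x)) w =
    eval_metric g c x (nabla_xi x u) (eval_endo phi c x w).
  by rewrite nabla_phi_reeb// eval_metricNl phi_skew// opprK.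
have [nabla_phiE nabla_xiE] := sasakian_tensors
  (fun u => phi_sqr acm u Ux) (eta_xi acm Ux) (phi_xi acm Ux)
  (fun u => eta_phi acm u Ux) (fun u v => metric_sym u v Ux) glin
  (fun u v => phi_skew u v Ux) (fun u => g_xi acm u Ux) alin blin
  (fun u v w => nabla_phi_skew u v w Ux)
  (fun u v w => nabla_phi_cyclic u v w Ux) anorm
  (fun u v => nabla_xi_contact u v Ux) (fun u => nabla_xi_unit u Ux) axi.
split=> [u v|u]; apply: (eval_metric_inj g_R Ux) => w.
- rewrite eval_metricDl eval_metricNl !eval_metricZl (metric_sym (xi c x))//.
  by rewrite (g_xi acm).
- by rewrite nabla_xiE eval_metricNl.
Qed.

Let TW := tanaka_webster phi xi eta g nabla.

Lemma tanaka_webster_lin x a b u v w : U x ->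
  TW c x u (a *: v + b *: w) = a *: TW c x u v + b *: TW c x u w.
Proof.
move=> Ux; rewrite /TW /tanaka_webster nabla_linr// -[b *: w]addr0 nabla_linr//.
rewrite nabla_0r// !addr0 eval_formD !eval_formZ eval_endoD !eval_endoZ.
rewrite eval_metricDr !eval_metricZr; apply/rowP => i; rewrite !mxE; ring.
Qed.

(** The three lemmas that follow say that xi, phi and eta are parallel: the
    correction terms of the Tanaka-Webster connection are exactly those that
    cancel the right-hand sides of sasakian_nabla. *)
Lemma tanaka_webster_xi x u : U x ->
  'D_u (xi c) x + TW c x u (xi c x) = 0.
Proof.
move=> Ux; have := (sasakian_nabla Ux).2 u; rewrite nabla_field.unlock.
rewrite /TW /tanaka_webster !addrA => ->.
rewrite (phi_xi acm)// (eta_xi acm)// (g_xi acm)// (eta_phi acm)//.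
by rewrite scaler0 addr0 scale1r addNr scale0r subr0.
Qed.

Lemma tanaka_webster_phi x u v : U x ->
  v *m 'D_u (phi c) x + TW c x u (eval_endo phi c x v) =
  eval_endo phi c x (TW c x u v).
Proof.
move=> Ux; rewrite -derive_phi// derive_phiE (sasakian_nabla Ux).1.
rewrite /TW /tanaka_webster !(eval_endoD, eval_endoN, eval_endoZ).
rewrite !(phi_sqr acm)// (phi_xi acm)// (eta_phi acm)// (g_phi acm u v)//.
apply/rowP => i; rewrite !mxE; ring.
Qed.

Lemma tanaka_webster_eta x u v : U x ->
  'D_u (fun y => eval_form eta c y v) x = eval_form eta c x (TW c x u v).
Proof.
move=> Ux; rewrite derive_eta// (sasakian_nabla Ux).2 (g_xi acm)//.
rewrite /TW /tanaka_webster -scaleNr !eval_formD !eval_formZ.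
rewrite !(eta_phi acm)// (eta_xi acm)// eval_metricNr (metric_sym v)//; ring.
Qed.

End Chart.

(** * Vector fields along a curve *)

Section Along.
Variables (R : realType) (m : nat) (N : smooth_manifold R m).
Variables (I : set R) (alpha : R -> N).
Hypotheses (I_open : open I) (alpha_smooth : smooth_curve I alpha).

(** Smoothness along the curve is only asked on the sets curve_dom c, and a
    derivative on such a set depends only on the values there because the set is
    open. *)
Lemma curve_dom_open c : open (curve_dom I alpha c).
Proof.
rewrite openE => t [It ct]; rewrite /interior.
have nI : nbhs t I by exact: open_nbhs_nbhs.
have nd : nbhs t (alpha @^-1` dom c).
  apply: (proj1 alpha_smooth t It); apply: open_nbhs_nbhs.
  by split=> //; exact: dom_open.
exact: filterI nI nd.
Qed.

Lemma coords_cod c t : curve_dom I alpha c t -> cod c (coords alpha c t).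
Proof. by move=> [_ ct]; exists (alpha t). Qed.

Lemma coords_overlap c c' t : curve_dom I alpha c t -> curve_dom I alpha c' t ->
  overlap c c' (coords alpha c t).
Proof. by move=> [_ ct] [_ c't]; exists (alpha t). Qed.

Lemma transition_coords c c' t : curve_dom I alpha c t ->
  transition c c' (coords alpha c t) = coords alpha c' t.
Proof. by move=> [_ ct]; rewrite /transition /coords /= chartK. Qed.

Lemma coords_smooth c : smooth_on (curve_dom I alpha c) (coords alpha c).
Proof. exact: (proj2 alpha_smooth c). Qed.

(** The coordinates in the chart c' are those in the chart c followed by the
    transition map; the chain rule gives the Jacobian. *)
Lemma velocity_field : is_field_along I alpha (velocity alpha).
Proof.
split=> [c|c c' t ct c't].
  exact: (@smooth_on_derive R R _ _ (coords alpha c) 1 (@coords_smooth c)).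
have dc := coords_smooth [::] ct.
have dT : differentiable (transition c c') (coords alpha c t).
  exact: (transition_smooth [::] (coords_overlap ct c't)).
rewrite -[RHS](deriveEjacobian _ dT).
rewrite -[RHS](@derive_comp _ _ _ _ (coords alpha c) _ t 1 dc dT).
apply: (derive_eq_open _ (curve_dom_open (c := c)) ct) => s cs.
by rewrite transition_coords.
Qed.

Lemma vector_field_along (X : vector_components N) :
  is_vector_field X -> is_field_along I alpha (vector_along alpha X).
Proof.
move=> [sX tX]; split=> [c|c c' t ct c't].
  exact: (smooth_on_comp (curve_dom_open (c := c)) (@coords_cod c)
    (@chart_open _ _ N c) (@coords_smooth c) (sX c)).
by rewrite /vector_along -tX ?transition_coords//; exact: coords_overlap.
Qed.

Lemma endo_field_along (phi : matrix_components N) V :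
  is_endomorphism_field phi -> is_field_along I alpha V ->
  is_field_along I alpha (endo_along alpha phi V).
Proof.
move=> [sphi tphi] [sV tV]; split=> [c|c c' t ct c't].
  apply: smooth_on_mulmx => //; first exact: curve_dom_open.
  exact: (smooth_on_comp (curve_dom_open (c := c)) (@coords_cod c)
    (@chart_open _ _ N c) (@coords_smooth c) (sphi c)).
rewrite /endo_along /eval_endo (tV c c')// -mulmxA.
rewrite -(transition_coords c' ct) tphi ?mulmxA//; exact: coords_overlap.
Qed.

Lemma lin_field_along a b V W :
  is_field_along I alpha V -> is_field_along I alpha W ->
  is_field_along I alpha (fun c t => a *: V c t + b *: W c t).
Proof.
move=> [sV tV] [sW tW]; split=> [c|c c' t ct c't].
  have o := curve_dom_open (c := c).
  by apply: smooth_onD => //; apply: smooth_onZ.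
by rewrite (tV c c')// (tW c c')// mulmxDl !scalemxAl.
Qed.

Lemma field_along_eq V W : along_eq I alpha V W -> is_field_along I alpha V ->
  is_field_along I alpha W.
Proof.
move=> VW [sV tV]; split=> [c|c c' t ct c't].
  by apply: smooth_on_eq (sV c) => //; [exact: curve_dom_open|exact: VW].
by rewrite -!VW//; exact: tV.
Qed.

Lemma scale_field_along a V : is_field_along I alpha V ->
  is_field_along I alpha (fun c t => a *: V c t).
Proof.
move=> fV; apply: field_along_eq (lin_field_along a 0 fV fV) => c t _.
by rewrite scale0r addr0.
Qed.

Lemma cov_along_eq G V W c t : along_eq I alpha V W -> curve_dom I alpha c t ->
  cov_along alpha G V c t = cov_along alpha G W c t.
Proof.
move=> VW ct; have dVW : 'D_1 (V c) t = 'D_1 (W c) t.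
  exact: (derive_eq_open _ (curve_dom_open (c := c)) ct (VW c)).
by rewrite /cov_along dVW (VW c t ct).
Qed.

Lemma form_along_chart (eta : form_components N) V c c' t :
  is_one_form eta -> is_field_along I alpha V ->
  curve_dom I alpha c t -> curve_dom I alpha c' t ->
  form_along alpha eta V c' t = form_along alpha eta V c t.
Proof.
move=> [_ teta] [_ tV] ct c't; rewrite /form_along /eval_form (tV c c')//.
rewrite -(transition_coords c' ct) -mulmxA teta//; exact: coords_overlap.
Qed.

End Along.

Section SasakianCurve.
Variables (R : realType) (m : nat) (N : smooth_manifold R m).
Variables (phi : matrix_components N) (xi : vector_components N).
Variables (eta : form_components N) (g : matrix_components N).
Variables (nabla : connection_components N).
Hypothesis sas : sasakian phi xi eta g.
Hypothesis lc : levi_civita g nabla.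
Variables (I : set R) (alpha : R -> N).
Hypotheses (I_open : open I) (alpha_smooth : smooth_curve I alpha).

Let acm : almost_contact_metric phi xi eta g := proj1 (proj1 sas).
Local Notation TW := (tanaka_webster phi xi eta g nabla).

Lemma cov_along_lin a b V W c t :
  is_field_along I alpha V -> is_field_along I alpha W -> curve_dom I alpha c t ->
  cov_along alpha TW (fun c s => a *: V c s + b *: W c s) c t =
  a *: cov_along alpha TW V c t + b *: cov_along alpha TW W c t.
Proof.
move=> [sV _] [sW _] ct; rewrite /cov_along.
rewrite (tanaka_webster_lin phi xi eta lc)//; last exact: coords_cod ct.
have dV := sV c [::] t ct; have dW := sW c [::] t ct.
rewrite deriveD; [|exact: diff_derivable (differentiableZ _ dV)|
  exact: diff_derivable (differentiableZ _ dW)].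
by rewrite !deriveZ; [rewrite !scalerDr addrACA|exact: diff_derivable dW|
  exact: diff_derivable dV].
Qed.

Lemma cov_along_scale a V c t :
  is_field_along I alpha V -> curve_dom I alpha c t ->
  cov_along alpha TW (fun c s => a *: V c s) c t =
  a *: cov_along alpha TW V c t.
Proof.
move=> fV ct; have := cov_along_lin a 0 fV fV ct; rewrite scale0r addr0 => <-.
apply: (cov_along_eq I_open alpha_smooth _ _ ct) => c' s _.
by rewrite scale0r addr0.
Qed.

Lemma cov_along_xi c t : curve_dom I alpha c t ->
  cov_along alpha TW (vector_along alpha xi) c t = 0.
Proof.
move=> ct; have cx := coords_cod ct.
rewrite /cov_along /vector_along (@derive_comp _ _ _ _ (coords alpha c) (xi c)).
- exact: tanaka_webster_xi.
- exact: (coords_smooth alpha_smooth [::] ct).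
- exact: (proj1 (xi_field acm) c [::] _ cx).
Qed.

Lemma cov_along_phi V c t : is_field_along I alpha V -> curve_dom I alpha c t ->
  cov_along alpha TW (endo_along alpha phi V) c t =
  endo_along alpha phi (cov_along alpha TW V) c t.
Proof.
move=> [sV _] ct; have cx := coords_cod ct.
have dV := sV c [::] t ct.
have dc := coords_smooth alpha_smooth [::] ct.
have dphi := proj1 (phi_field acm) c [::] _ cx.
rewrite /endo_along /cov_along /= eval_endoD -(tanaka_webster_phi sas lc)//.
rewrite (@derive_mulmx _ _ _ _ _ (V c) (fun s => phi c (coords alpha c s)) t 1
  dV (differentiable_comp dc dphi)).
rewrite (@derive_comp _ _ _ _ (coords alpha c) (phi c) t 1 dc dphi).
exact/esym/addrA.
Qed.

Lemma derive_form_along V c t : is_field_along I alpha V -> curve_dom I alpha c t ->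
  is_derive t 1 (form_along alpha eta V c)
    (form_along alpha eta (cov_along alpha TW V) c t).
Proof.
move=> [sV _] ct; have cx := coords_cod ct.
have dV := sV c [::] t ct.
have dc := coords_smooth alpha_smooth [::] ct.
have deta := proj1 (eta_form acm) c [::] _ cx.
have dce := differentiable_comp dc deta.
have dm :
    differentiable (fun s => V c s *m eta c (coords alpha c s)) t.
  exact: differentiable_mulmx.
apply: DeriveDef; first exact: diff_derivable (differentiable_entry 0 0 dm).
rewrite /form_along /eval_form -(@derive_entry R R 1 1 _ t 1 0 0 dm)
  (@derive_mulmx _ _ _ _ _ (V c) (fun s => eta c (coords alpha c s)) t 1 dV dce).
rewrite (@derive_comp _ _ _ _ (coords alpha c) (eta c) t 1 dc deta).
rewrite /cov_along mulmxDl [LHS]mxE [RHS]mxE; congr (_ + _).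
rewrite -[RHS](tanaka_webster_eta sas lc)//.
rewrite /eval_form -derive_entry; last exact: differentiable_mulmx.
by rewrite (derive_mulmx (P := fun=> V c t))// derive_cst mul0mx add0r.
Qed.

End SasakianCurve.

(** * Magnetic curves and their Frenet frames *)

Lemma interval_derive0_cst (R : realType) (I : set R) (h : R -> R) :
  is_interval I -> (forall t, I t -> is_derive t 1 h 0) ->
  forall s t, I s -> I t -> h s = h t.
Proof.
move=> Iint h0; suff lt s t : I s -> I t -> s <= t -> h s = h t.
  move=> s t Is It; have [st|ts] := leP s t; first exact: lt.
  by apply/esym/lt => //; exact: ltW.
move=> Is It st.
have Ist x : s <= x <= t -> I x by exact: Iint.
have [||c _] := @MVT_segment R h (fun=> 0) s t st.
- by move=> x; rewrite in_itv/= => /andP[sx xt]; apply/h0/Ist; rewrite !ltW.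
- apply: derivable_within_continuous => x; rewrite in_itv/= => /Ist/h0.
  by case.
by rewrite mul0r => /subr0_eq ->.
Qed.

Section Magnetic.
Variables (R : realType) (m : nat) (N : smooth_manifold R m).
Variables (phi : matrix_components N) (xi : vector_components N).
Variables (eta : form_components N) (g : matrix_components N).
Variables (nabla : connection_components N).
Hypothesis sas : sasakian phi xi eta g.
Hypothesis lc : levi_civita g nabla.
Variables (I : set R) (alpha : R -> N).
Hypotheses (I_open : open I) (I_interval : is_interval I).
Hypothesis I_nonempty : I !=set0.
Hypothesis alpha_smooth : smooth_curve I alpha.
Hypothesis alpha_unit : unit_speed I alpha g.

Let acm : almost_contact_metric phi xi eta g := proj1 (proj1 sas).
Local Notation TW := (tanaka_webster phi xi eta g nabla).
Local Notation E1 := (velocity alpha).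

Lemma metric_phi_self c x u : cod c x ->
  eval_metric g c x u (eval_endo phi c x u) = 0.
Proof.
move=> cx; have := phi_skew sas u u cx.
rewrite (metric_sym sas (eval_endo phi c x u))//; lra.
Qed.

Lemma metric_xi_phi c x u : cod c x ->
  eval_metric g c x (xi c x) (eval_endo phi c x u) = 0.
Proof. by move=> cx; rewrite (metric_sym sas)// (g_xi acm)// (eta_phi acm). Qed.

Lemma metric_xi_xi c x : cod c x -> eval_metric g c x (xi c x) (xi c x) = 1.
Proof. by move=> cx; rewrite (g_xi acm)// (eta_xi acm). Qed.

(** eta is parallel and kills phi E1, so eta(E1) has zero derivative.  The charts
    may change along the curve: a function on the whole interval is obtained by
    choosing a chart at each time, and near each time it agrees with the
    expression in one fixed chart. *)
Lemma magnetic_slant q : magnetic I alpha phi eta TW q ->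
  exists k, forall c t, curve_dom I alpha c t -> form_along alpha eta E1 c t = k.
Proof.
move=> mag; pose chart_at t := sval (cid (dom_cover (alpha t))).
have chart_atP t : I t -> curve_dom I alpha (chart_at t) t.
  by move=> It; split=> //; exact: svalP (cid (dom_cover (alpha t))).
have vf := velocity_field I_open alpha_smooth.
pose h t := form_along alpha eta E1 (chart_at t) t.
have hE c t : curve_dom I alpha c t -> h t = form_along alpha eta E1 c t.
  move=> ct; apply: (form_along_chart (eta_form acm) vf ct).
  by apply: chart_atP; case: ct.
have [t0 It0] := I_nonempty; exists (h t0) => c t ct; rewrite -hE//.
apply: (interval_derive0_cst I_interval) => [s Is| |//]; last by case: ct.
have cs := chart_atP s Is.
have -> : 0 = form_along alpha eta (cov_along alpha TW E1) (chart_at s) s.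
  rewrite /form_along (mag _ _ cs) eval_formZ.
  by rewrite (eta_phi acm) ?mulr0//; exact: coords_cod cs.
apply: near_eq_is_derive (derive_form_along sas lc alpha_smooth vf cs).
have := open_nbhs_nbhs (conj (curve_dom_open I_open alpha_smooth (c := chart_at s)) cs).
by apply: filterS => r cr; rewrite (hE _ _ cr).
Qed.

(** Both the bound on the contact angle and the norm of the third Frenet vector
    come from this: it is the squared distance from xi to its projection on E1. *)
Lemma metric_reeb_defect k c t : curve_dom I alpha c t ->
  form_along alpha eta E1 c t = k ->
  metric_along alpha g (fun c t => vector_along alpha xi c t - k *: E1 c t)
    (fun c t => vector_along alpha xi c t - k *: E1 c t) c t = 1 - k ^+ 2.
Proof.
move=> ct ek; have cx := coords_cod ct; have := alpha_unit ct.
rewrite /metric_along => vv; rewrite !eval_metricE vv metric_xi_xi//.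
rewrite (metric_sym sas (xi c _))// (g_xi acm)//.
by rewrite -[eval_form _ _ _ _]/(form_along alpha eta E1 c t) ek; ring.
Qed.

Lemma metric_ge0 c x u : cod c x -> 0 <= eval_metric g c x u u.
Proof.
move=> cx; have [->|u0] := eqVneq u 0.
  by rewrite /eval_metric mul0mx mul0mx mxE.
by have [_ _ _ gpos] := g_riemannian acm; exact/ltW/gpos.
Qed.

(** Non-negativity of the squared norm of xi - k E1. *)
Lemma slant_bound k :
  (forall c t, curve_dom I alpha c t -> form_along alpha eta E1 c t = k) ->
  -1 <= k <= 1.
Proof.
move=> ek; have [t It] := I_nonempty; have [c dt] := dom_cover (alpha t).
have ct : curve_dom I alpha c t by [].
have := metric_ge0 (vector_along alpha xi c t - k *: E1 c t) (coords_cod ct).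
have := metric_reeb_defect ct (ek _ _ ct); rewrite /metric_along => ->.
rewrite subr_ge0 => k1.
by rewrite -ler_norml -(@ler_pXn2r _ 2)// ?nnegrE// expr1n real_normK// num_real.
Qed.

Lemma geodesic_of_cov0 :
  along_eq I alpha (cov_along alpha TW E1) (fun _ _ => 0) ->
  geodesic I alpha g TW (fun=> E1) (fun _ _ => 0).
Proof.
move=> cov0; split; [split=> // i _|move=> i j|move=> i|move=> i].
- exact: velocity_field.
- rewrite -!eqn_leq => /eqP <- /eqP <- c t ct; rewrite eqxx; exact: alpha_unit.
- by case: i => [|[]].
- rewrite -eqn_leq => /eqP <- c t ct; rewrite cov0//= addr0//.
Qed.

(** A Frenet frame has E 1 equal to the velocity only on the interval; this is
    its first equation, in terms of the velocity itself. *)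
Lemma frenet_cov1 r E k : frenet I alpha g TW r E k ->
  along_eq I alpha (cov_along alpha TW E1)
    (fun c t => if (1 < r)%N then k 1%N t *: E 2%N c t else 0).
Proof.
move=> [[r0 _ E1E] _ _ cov] c t ct.
have -> : cov_along alpha TW E1 c t = cov_along alpha TW (E 1%N) c t.
  by apply: (cov_along_eq I_open alpha_smooth _ _ ct) => c' s cs; rewrite E1E.
by rewrite (cov 1%N)//= add0r.
Qed.

Definition circle_frame (q : R) (i : nat) : along N :=
  if i == 1%N then E1 else fun c t => - Num.sg q *: endo_along alpha phi E1 c t.

Definition helix_frame (q theta : R) (i : nat) : along N :=
  match i with
  | 1%N => E1
  | 2%N => fun c t => (Num.sg (- q + 2 * cos theta) / sin theta)
                        *: endo_along alpha phi E1 c t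
  | _ => fun c t => (Num.sg (cos theta) / sin theta)
                        *: (vector_along alpha xi c t - cos theta *: E1 c t)
  end.

Let phiE1_field : is_field_along I alpha (endo_along alpha phi E1).
Proof.
by apply: endo_field_along => //; [exact: phi_field acm|exact: velocity_field].
Qed.

(** So the unit normal of a slant curve is phi E1 divided by sin theta. *)
Lemma metric_phiE1 k c t : curve_dom I alpha c t ->
  form_along alpha eta E1 c t = k ->
  metric_along alpha g (endo_along alpha phi E1) (endo_along alpha phi E1) c t
  = 1 - k ^+ 2.
Proof.
move=> ct ek; have cx := coords_cod ct; have := alpha_unit ct.
rewrite /metric_along (g_phi acm)// => <-.
by rewrite -[eval_form _ _ _ _]/(form_along alpha eta E1 c t) ek addrK.
Qed.

Lemma cov_phiE1 q k c t : magnetic I alpha phi eta TW q ->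
  curve_dom I alpha c t -> form_along alpha eta E1 c t = k ->
  cov_along alpha TW (endo_along alpha phi E1) c t =
  (- q + 2 * k) *: (- E1 c t + k *: vector_along alpha xi c t).
Proof.
move=> mag ct ek; have vf := velocity_field I_open alpha_smooth.
rewrite (cov_along_phi sas lc alpha_smooth vf ct) /endo_along (mag _ _ ct) ek.
rewrite eval_endoZ (phi_sqr acm); last exact: coords_cod ct.
by rewrite -[eval_form _ _ _ _]/(form_along alpha eta E1 c t) ek.
Qed.

(** With k = 0 the plane spanned by E1 and phi E1 is closed under
    differentiation: E1' = - q phi E1 and (phi E1)' = q E1. *)
Lemma magnetic_circle q : q != 0 -> magnetic I alpha phi eta TW q ->
  legendre I alpha eta ->
  circle I alpha g TW (circle_frame q) (fun _ _ => `|q|).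
Proof.
move=> q0 mag leg; have vf := velocity_field I_open alpha_smooth.
have sg2 : Num.sg q * Num.sg q = 1 by rewrite -expr2 sqr_sg q0.
split; last by exists `|q|.
split; [split=> // i _|move=> i j|by move=> i _ t _; rewrite normr_gt0|move=> i].
- rewrite /circle_frame; case: ifP => _ //.
  exact: scale_field_along.
- move=> ij ji c t ct; have cx := coords_cod ct.
  move: i j ij ji => [|[|[|i]]]// [|[|[|j]]]// _ _; rewrite /circle_frame/=.
  + exact: alpha_unit.
  + by rewrite /metric_along eval_metricZr metric_phi_self// mulr0.
  + by rewrite /metric_along eval_metricZl (metric_sym sas)// metric_phi_self// mulr0.
  + have := metric_phiE1 ct (leg _ _ ct); rewrite /metric_along => e.
    by rewrite eval_metricZl eval_metricZr e mulrA mulrNN sg2; ring.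
- move: i => [|[|[|i]]]// _ c t ct; rewrite /circle_frame/= ?addr0 ?add0r.
  + rewrite mag// (leg _ _ ct) mulr0 addr0 scalerA mulrN [_ * Num.sg q]mulrC.
    by rewrite -numEsg.
  + rewrite (cov_along_scale phi xi eta lc I_open alpha_smooth _ phiE1_field ct).
    rewrite (cov_phiE1 mag ct (leg _ _ ct)) mulr0 addr0 scale0r addr0.
    by rewrite scalerA mulrNN -normrEsg scalerN scaleNr.
Qed.

(** Since k <> 0, the derivative of phi E1 leaves the plane spanned by E1 and
    phi E1 in the direction xi - k E1, whose own derivative is a multiple of
    phi E1; so the frame closes up at order three.  The signs delta and eps make
    both curvatures positive. *)
Lemma magnetic_helix q theta : magnetic I alpha phi eta TW q ->
  (forall c t, curve_dom I alpha c t -> form_along alpha eta E1 c t = cos theta) ->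
  - q + 2 * cos theta != 0 -> cos theta != 0 -> 0 < sin theta ->
  helix I alpha g TW (helix_frame q theta)
    (fun i _ => if i == 1%N then `|- q + 2 * cos theta| * sin theta
     else `|- q + 2 * cos theta| * Num.sg (cos theta) * cos theta).
Proof.
move=> mag ek; set l := - q + 2 * cos theta; move=> l0 C0 s0.
have vf := velocity_field I_open alpha_smooth.
have := cos2Dsin2 theta; rewrite /helix_frame -/l.
set C := cos theta in ek C0 *; set s := sin theta in s0 *.
set d := Num.sg l; set e := Num.sg C => Cs.
have s2 : s ^+ 2 = 1 - C ^+ 2 by rewrite -Cs; ring.
have d2 : d ^+ 2 = 1 by rewrite sqr_sg l0.
have e2 : e ^+ 2 = 1 by rewrite sqr_sg C0.
have dl : `|l| = d * l by rewrite normrEsg.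
have s_neq0 : s != 0 by rewrite gt_eqF.
have k1_gt0 : 0 < `|l| * s by rewrite mulr_gt0// normr_gt0.
have k2_gt0 : 0 < `|l| * e * C.
  by rewrite -mulrA mulr_gt0// ?normr_gt0// /e -normrEsg normr_gt0.
have xif : is_field_along I alpha (vector_along alpha xi).
  exact: vector_field_along (xi_field acm).
have wf : is_field_along I alpha
    (fun c t => vector_along alpha xi c t - C *: E1 c t).
  apply: field_along_eq (lin_field_along I_open alpha_smooth 1 (- C) xif vf) => //.
  by move=> c t _; rewrite scale1r scaleNr.
have covw c t : curve_dom I alpha c t ->
    cov_along alpha TW (fun c t => vector_along alpha xi c t - C *: E1 c t) c t
    = - (C * l) *: endo_along alpha phi E1 c t.
  move=> ct; transitivity (cov_along alpha TW
      (fun c t => 1 *: vector_along alpha xi c t + (- C) *: E1 c t) c t).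
    apply: (cov_along_eq I_open alpha_smooth _ _ ct) => c' r _.
    by rewrite scale1r scaleNr.
  rewrite (cov_along_lin phi xi eta lc 1 (- C) xif vf ct).
  rewrite (cov_along_xi sas lc alpha_smooth ct) scaler0 add0r mag// (ek _ _ ct).
  by rewrite scalerA mulNr.
split; last first.
  by exists (`|l| * s), (`|l| * e * C); split.
split; [split=> //|move=> i j|by move=> i; case: ifP|move=> i].
- by move=> [|[|[|[|i]]]]// _; exact: scale_field_along.
- move=> ij ji c t ct; have cx := coords_cod ct.
  have m11 := alpha_unit ct.
  have m22 := metric_phiE1 ct (ek _ _ ct).
  have m33 := metric_reeb_defect ct (ek _ _ ct).
  have m12 : metric_along alpha g E1 (endo_along alpha phi E1) c t = 0.
    exact: metric_phi_self.
  have m1x : metric_along alpha g E1 (vector_along alpha xi) c t = C.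
    by rewrite -(ek _ _ ct); exact: (g_xi acm _ cx).
  have m2x : metric_along alpha g (vector_along alpha xi)
      (endo_along alpha phi E1) c t = 0.
    exact: metric_xi_phi.
  have sym V W : metric_along alpha g V W c t = metric_along alpha g W V c t.
    exact: (metric_sym sas _ _ cx).
  have i13 : metric_along alpha g E1
      (fun c t => vector_along alpha xi c t - C *: E1 c t) c t = 0.
    rewrite /metric_along in m1x m11 *.
    by rewrite eval_metricDr eval_metricNr eval_metricZr m1x m11; ring.
  have i23 : metric_along alpha g (endo_along alpha phi E1)
      (fun c t => vector_along alpha xi c t - C *: E1 c t) c t = 0.
    rewrite sym; rewrite /metric_along in m2x m12 *.
    by rewrite eval_metricDl eval_metricNl eval_metricZl m2x m12; ring.
  have sc a b V W :
    metric_along alpha g (fun c t => a *: V c t) (fun c t => b *: W c t) c t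
    = a * b * metric_along alpha g V W c t.
    by rewrite /metric_along eval_metricZl eval_metricZr mulrA.
  have sc1 b V W : metric_along alpha g V (fun c t => b *: W c t) c t
     = b * metric_along alpha g V W c t.
    by rewrite /metric_along eval_metricZr.
  move: i j ij ji => [|[|[|[|i]]]]// [|[|[|[|j]]]]// _ _ /=.
  + by rewrite sc1 m12 mulr0.
  + by rewrite sc1 i13 mulr0.
  + by rewrite sym sc1 m12 mulr0.
  + by rewrite sc m22 -s2 mulf_div -!expr2 d2 mul1r mulVf// expf_neq0.
  + by rewrite sc i23 mulr0.
  + by rewrite sym sc1 i13 mulr0.
  + by rewrite sym sc i23 mulr0.
  + rewrite sc m33 -s2 mulf_div -!expr2 e2 mul1r mulVf//.
    by rewrite expf_neq0.
- move: i => [|[|[|[|i]]]]// _ c t ct /=; rewrite ?addr0 ?add0r.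
  + rewrite mag// (ek _ _ ct) scalerA; congr (_ *: _).
    rewrite -/l dl; transitivity (d ^+ 2 * l); first by rewrite d2 mul1r.
    by field.
  + rewrite (cov_along_scale phi xi eta lc I_open alpha_smooth _ phiE1_field ct).
    rewrite (cov_phiE1 mag ct (ek _ _ ct)) -/l dl.
    apply/rowP => i; rewrite !mxE.
    move: (E1 c t 0 i) (vector_along alpha xi c t 0 i) => v x.
    (* with e ^+ 2 = 1 and C ^+ 2 + s ^+ 2 = 1, both sides equal
       d * l / s * (C * x - v) *)
    transitivity (- (d * l * s) * v + d * l * e ^+ 2 * C / s * x
      - d * l * e ^+ 2 * C ^+ 2 / s * v); last by field.
    rewrite e2; have -> : C ^+ 2 = 1 - s ^+ 2 by rewrite s2; ring.
    by field.
  + rewrite (cov_along_scale phi xi eta lc I_open alpha_smooth _ wf ct) covw//.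
    rewrite dl !scalerA; congr (_ *: _).
    transitivity (- (d ^+ 2 * (e * C * l / s))); last by field.
    by rewrite d2; field.
Qed.

End Magnetic.

(** * The classification *)

Unset Implicit Arguments.
Set Strict Implicit.

Theorem theorem1 (R : realType) (n : nat) (N : smooth_manifold R (2 * n).+1)
    (phi : matrix_components N) (xi : vector_components N)
    (eta : form_components N) (g : matrix_components N)
    (nabla : connection_components N)
    (sasakian_N : sasakian phi xi eta g)
    (nabla_LC : levi_civita g nabla)
    (q : R) (q_neq0 : q != 0)
    (I : set R) (I_open : open I) (I_interval : is_interval I)
    (I_nonempty : I !=set0)
    (alpha : R -> N) (alpha_smooth : smooth_curve I alpha)
    (alpha_unit : unit_speed I alpha g) :
  let TW := tanaka_webster phi xi eta g nabla in
  let E1 := velocity alpha in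
  magnetic I alpha phi eta TW q <->
  (* (a) *)
  (exists (theta : R) E k,
     [/\ geodesic I alpha g TW E k,
         slant I alpha eta theta,
         ~ legendre I alpha eta
       & [\/ cos theta = q / 2,
             along_eq I alpha E1 (vector_along alpha xi)
           | along_eq I alpha E1 (fun c t => - vector_along alpha xi c t)]])
  \/
  (* (b) *)
  (exists E k,
     [/\ circle I alpha g TW E k,
         legendre I alpha eta,
         forall t, I t -> k 1%N t = `|q|
       & along_eq I alpha (E 2%N)
           (fun c t => - Num.sg q *: endo_along alpha phi E1 c t)])
  \/
  (* (c) *)
  (exists (theta : R) E k,
     let delta := Num.sg (- q + 2 * cos theta) in
     let eps := Num.sg (cos theta) in
     [/\ helix I alpha g TW E k,
         slant I alpha eta theta,
         cos theta != q / 2,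
         forall t, I t ->
           k 1%N t = `|- q + 2 * cos theta| * sin theta /\
           k 2%N t = `|- q + 2 * cos theta| * eps * cos theta
       & along_eq I alpha (E 2%N)
           (fun c t => (delta / sin theta) *: endo_along alpha phi E1 c t) /\
         along_eq I alpha (E 3%N)
           (fun c t => (eps / sin theta) *:
              (vector_along alpha xi c t - cos theta *: E1 c t))]).
Proof.
move=> TW E1.
have acm : almost_contact_metric phi xi eta g := proj1 (proj1 sasakian_N).
have [t0 It0] := I_nonempty; have [c0 d0] := dom_cover (alpha t0).
have ct0 : curve_dom I alpha c0 t0 by [].
split=> [mag|].
- have [k ek] := magnetic_slant sasakian_N nabla_LC I_open I_interval I_nonempty
    alpha_smooth mag.
  have k1 := slant_bound sasakian_N I_nonempty alpha_unit ek.
  have ck : cos (acos k) = k by apply: acosK; rewrite in_itv.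
  have thP : 0 <= acos k <= pi by rewrite acos_ge0// acos_lepi.
  have s0 : 0 <= sin (acos k) by rewrite sin_ge0_pi.
  have slk : slant I alpha eta (acos k) by split=> // c t /ek ->; rewrite ck.
  have nleg : k != 0 -> ~ legendre I alpha eta.
    by move=> k0 /(_ _ _ ct0); rewrite (ek _ _ ct0) => /eqP; apply/negP.
  have [kq|kq] := eqVneq k (q / 2).
    (* the magnetic force vanishes; q != 0 is what makes the curve non-Legendre *)
    left; exists (acos k), (fun=> E1), (fun _ _ => 0); split=> //.
    - apply: geodesic_of_cov0 => // c t ct; rewrite mag// (ek _ _ ct) kq.
      by rewrite mulrC divfK ?pnatr_eq0// addNr scale0r.
    - by apply: nleg; rewrite kq mulf_neq0// invr_eq0 pnatr_eq0.
    - by apply: Or31; rewrite ck.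
  have [sk0|sk0] := eqVneq (sin (acos k)) 0.
    (* here k = 1 or k = -1, and the velocity is k xi *)
    have kk : k ^+ 2 = 1.
      by have := cos2Dsin2 (acos k); rewrite ck sk0 expr0n addr0.
    have xiE c t : curve_dom I alpha c t ->
        vector_along alpha xi c t = k *: velocity alpha c t.
      move=> ct; have := metric_reeb_defect sasakian_N alpha_unit ct (ek _ _ ct).
      rewrite kk subrr /metric_along.
      move=> /(eval_metric_eq0 (g_riemannian acm) (coords_cod ct)).
      exact: subr0_eq.
    have E1E c t : curve_dom I alpha c t ->
        velocity alpha c t = k *: vector_along alpha xi c t.
      by move=> /xiE ->; rewrite scalerA -expr2 kk scale1r.
    left; exists (acos k), (fun=> E1), (fun _ _ => 0); split=> //.
    - apply: geodesic_of_cov0 => // c t ct; rewrite mag// /endo_along E1E//.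
      rewrite eval_endoZ /vector_along (phi_xi acm) ?scaler0//.
      exact: coords_cod ct.
    - by apply: nleg; apply: contra_eq_neq kk => ->; rewrite expr0n eq_sym oner_neq0.
    - move/eqP: kk; rewrite sqrf_eq1 => /orP[|] /eqP kE.
        by apply: Or32 => c t ct; rewrite [LHS]E1E// kE scale1r.
      by apply: Or33 => c t ct; rewrite [LHS]E1E// kE scaleN1r.
  have s_gt0 : 0 < sin (acos k) by rewrite lt_def sk0.
  right; have [k0|k0] := eqVneq k 0.
    have leg : legendre I alpha eta by move=> c t /ek ->.
    left; exists (circle_frame phi alpha q), (fun _ _ => `|q|); split=> //.
    exact: magnetic_circle.
  right; exists (acos k), (helix_frame phi xi alpha q (acos k)); eexists.
  split.
  + apply: magnetic_helix => //; rewrite ck//.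
    apply: contra kq => /eqP e; apply/eqP.
    by move: e; clear; lra.
  + by [].
  + by rewrite ck.
  + by [].
  + by [].
- case=> [|[]].
  + move=> [theta [E [k [geo [_ sl] _ H]]]] c t ct.
    rewrite (frenet_cov1 I_open alpha_smooth geo ct)/=.
    case: H => [cq|eE|eE].
    * by rewrite (sl _ _ ct) cq mulrC divfK ?pnatr_eq0// addNr scale0r.
    * rewrite /endo_along -[velocity alpha c t]/(E1 c t) (eE _ _ ct).
      rewrite (phi_xi acm) ?scaler0//.
      exact: coords_cod ct.
    * rewrite /endo_along -[velocity alpha c t]/(E1 c t) (eE _ _ ct) eval_endoN.
      rewrite (phi_xi acm) ?oppr0 ?scaler0//.
      exact: coords_cod ct.
  + move=> [E [k [[fr _] leg kE E2]]] c t ct.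
    rewrite (frenet_cov1 I_open alpha_smooth fr ct)/= (E2 _ _ ct) kE; last by case: ct.
    by rewrite (leg _ _ ct) mulr0 addr0 scalerA mulrN [_ * Num.sg q]mulrC -numEsg.
  + move=> [theta [E [k [hel [_ sl] cq kE [E2 _]]]]] c t ct.
    have [fr [k1 [k2 [k1_gt0 _ kc]]]] := hel.
    have It : I t by case: ct.
    rewrite (frenet_cov1 I_open alpha_smooth fr ct)/= (E2 _ _ ct) (sl _ _ ct).
    (* division by sin theta is legitimate because k 1 is positive *)
    have s_neq0 : sin theta != 0.
      apply: contraTneq k1_gt0 => s0; rewrite -(kc _ It).1 (kE _ It).1 s0 mulr0.
      by rewrite ltxx.
    rewrite (kE _ It).1 scalerA; congr (_ *: _).
    by rewrite mulrCA mulfK// -numEsg.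
Qed.
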